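(* There exist absolute constants $c_0,C_0>0$ such that the following holds. Assume $n^{-0.49}\le\epsilon\le c_0$ and $W\ge n^{C_0}$. Then any randomized turnstile streaming algorithm that, on every unit update turnstile stream on $\mathbb Z^n$ of length at most $W$, outputs a $(1+\epsilon)$-approximation to the $L_0$ norm of the final frequency vector with success probability at least $2/3$ must use $\Omega\left(\frac{\epsilon^{-2}\log n\,\log\log W}{\log(\epsilon^{-2}\log n\,\log\log W)}\right)$ bits of space. Furthermore, if $W\ge(\epsilon^{-2}\log n)^{C_0\epsilon^{-2}\log n}$, then the algorithm must use $\Omega(\epsilon^{-2}\log n\cdot\log\log W)$ bits of space.
   Context: The $L_0$ norm $\|x\|_0$ is the number of nonzero coordinates of $x$; a $(1+\epsilon)$-approximation is a value $z$ with $(1-\epsilon)\|x\|_0\le z\le(1+\epsilon)\|x\|_0$. A unit update turnstile stream is a sequence of updates $(i,\Delta)$, $i\in[n]$, $\Delta\in\{\pm1\}$, each adding $\Delta$ to coordinate $i$ of a vector starting at $0$. A randomized streaming algorithm using $S$ bits is a public-coin family of deterministic streaming algorithms each with at most $2^S$ memory states; the seed is not counted toward the space and success probability is over the seed for each fixed stream. *)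

(* Defs.v *)
From HB Require Import structures.
From mathcomp Require Import all_boot all_order all_algebra.
From mathcomp Require Import all_classical all_reals all_analysis.

Set Implicit Arguments.
Unset Strict Implicit.
Unset Printing Implicit Defensive.

Import Order.TTheory GRing.Theory Num.Theory.
Local Open Scope ring_scope.

Definition update (n : nat) : Type := ('I_n * int)%type.

Definition stream (n : nat) : Type := seq (update n).

Definition unit_update_stream (n : nat) (s : stream n) : Prop :=
  all (fun u : update n => (u.2 == 1) || (u.2 == -1)) s.

Definition frequency_vector (n : nat) (s : stream n) : 'rV[int]_n :=
  \sum_(u <- s) u.2 *: delta_mx 0 u.1.

Definition L0norm (n : nat) (x : 'rV[int]_n) : nat :=
  #|[set i : 'I_n | x ord0 i != 0]|%SET.

Definition approximates (R : realType) (n : nat) (eps : R) (x : 'rV[int]_n)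
    (z : R) : Prop :=
  (1 - eps) * (L0norm x)%:R <= z /\ z <= (1 + eps) * (L0norm x)%:R.

Record det_algorithm (R : realType) (n : nat) := DetAlgorithm {
  memory : finType;
  initial : memory;
  process : memory -> update n -> memory;
  answer : memory -> R }.

Definition output (R : realType) (n : nat) (A : det_algorithm R n)
    (s : stream n) : R :=
  answer (foldl (@process R n A) (@initial R n A) s).

Section RandomizedAlgorithm.
Context (R : realType) (d : measure_display) (Seed : measurableType d).
Variables (P : probability Seed R) (n : nat) (A : Seed -> det_algorithm R n).

Definition uses_space (S : nat) : Prop :=
  forall w : Seed, (#|memory (A w)| <= 2 ^ S)%N.

Definition success_event (eps : R) (s : stream n) : set Seed :=
  [set w | approximates eps (frequency_vector s) (output (A w) s)]%classic.

(* The measure of a non-measurable set carries no meaning, so measurability of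
   the success event is part of "succeeds with probability at least 2/3"; no
   other measurability is required of the family A. *)
Definition approximates_L0 (eps : R) (W : nat) : Prop :=
  forall s : stream n, unit_update_stream s -> (size s <= W)%N ->
    measurable (success_event eps s) /\
    ((2 / 3 : R)%:E <= P (success_event eps s))%E.

End RandomizedAlgorithm.

(* Main.v *)
(* Alice streams a vector on a grid of about [ln n] levels of about [eps ^- 2]
   positions, a position at level [l] standing for [2 ^ l] coordinates, and Bob
   deletes his own counts so that everything above one level cancels. The L0 norm
   then reveals, up to the error [eps], the correlation of their bits on that
   level. By Yao's principle and Khintchine's inequality the memory must be
   correlated with a constant fraction of the bits of an average level. If the
   memory is the only source of information about each bit, the chain rule for
   conditional entropy yields [S >= c * eps ^- 2 * ln n].
   For the factor [ln (ln W)] Alice streams many rounds of random counts and hides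
   each bit as a shift by [N`!] of a total count. On repeated updates a machine
   is eventually periodic. If the memory in the middle of a round carries less
   than about [ln N] of entropy on a count, some state recurs at two values of
   the count at distance at most [N]; the law of the final memory then nearly has
   a period dividing [N`!], and the shift goes unnoticed. This presupposes that
   the final memory depends on the round only through the totals that are
   revealed, which an energy argument shows for a typical round. So a hidden bit
   costs about [ln N], and [N = (ln W)^(1/4)] fits into a stream of length [W]
   unless [S] is already of order [ln W]. *)
Require Import Defs.
From HB Require Import structures.
From mathcomp Require Import all_boot all_order all_algebra all_fingroup.
From mathcomp Require Import all_classical all_reals all_analysis.
From mathcomp Require Import measurable_realfun ring lra zify.

Set Implicit Arguments.
Unset Strict Implicit.
Unset Printing Implicit Defensive.

Import Order.TTheory GRing.Theory Num.Theory.
Local Open Scope ring_scope.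

(** * Averages *)

Definition avg {R : realFieldType} (T : finType) (f : T -> R) : R :=
  (\sum_x f x) / #|T|%:R.

Notation "\avg_ x F" := (avg (fun x => F))
  (at level 34, F at level 41, x at level 0, right associativity).
Notation "\avg_ ( x : T ) F" := (avg (fun x : T => F))
  (at level 34, F at level 41, x at level 50, right associativity, only parsing).

Section Average.
Context {R : realFieldType}.
Implicit Types T U : finType.

Lemma eq_avg T (f g : T -> R) : f =1 g -> avg f = avg g.
Proof. by move=> fg; rewrite /avg (eq_bigr g). Qed.

Lemma avgD T (f g : T -> R) : \avg_x (f x + g x) = avg f + avg g.
Proof. by rewrite /avg big_split mulrDl. Qed.

Lemma avgB T (f g : T -> R) : \avg_x (f x - g x) = avg f - avg g.
Proof. by rewrite /avg sumrB mulrBl. Qed.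

Lemma avgMl T c (f : T -> R) : \avg_x (c * f x) = c * avg f.
Proof. by rewrite /avg -mulr_sumr mulrA. Qed.

Lemma avgMr T c (f : T -> R) : \avg_x (f x * c) = avg f * c.
Proof. by rewrite /avg -mulr_suml mulrAC. Qed.

Lemma avg_sum T I (r : seq I) (P : pred I) (f : T -> I -> R) :
  \avg_x \sum_(i <- r | P i) f x i = \sum_(i <- r | P i) \avg_x f x i.
Proof. by rewrite /avg exchange_big mulr_suml. Qed.

Lemma avg_cst T (x0 : T) (c : R) : \avg_(_ : T) c = c.
Proof.
rewrite /avg sumr_const -[c *+ _]mulr_natr mulfK// pnatr_eq0 -lt0n.
by apply/card_gt0P; exists x0.
Qed.

Lemma avg_unit (f : unit -> R) : avg f = f tt.
Proof. by rewrite -[RHS](avg_cst tt); apply: eq_avg => -[]. Qed.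

Lemma pair_avg T U (f : T -> U -> R) :
  \avg_x \avg_y f x y = \avg_(p : T * U) f p.1 p.2.
Proof.
rewrite /avg -mulr_suml pair_bigA card_prod natrM -mulrA; congr (_ * _).
by rewrite mulrC -invfM.
Qed.

Lemma avg_pair T U (f : T * U -> R) : avg f = \avg_x \avg_y f (x, y).
Proof. by rewrite pair_avg; apply: eq_avg => -[]. Qed.

Lemma exchange_avg T U (f : T -> U -> R) :
  \avg_x \avg_y f x y = \avg_y \avg_x f x y.
Proof. by rewrite /avg -!mulr_suml exchange_big mulrAC. Qed.

Lemma reindex_avg T U (h : T -> U) (f : U -> R) :
  bijective h -> avg f = \avg_x f (h x).
Proof.
move=> h_bij; rewrite /avg (reindex h); last exact: onW_bij.
by rewrite (bij_eq_card h_bij).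
Qed.

Lemma ler_avg T (f g : T -> R) : (forall x, f x <= g x) -> avg f <= avg g.
Proof. by move=> fg; rewrite ler_wpM2r ?invr_ge0// ler_sum. Qed.

Lemma avg_ge0 T (f : T -> R) : (forall x, 0 <= f x) -> 0 <= avg f.
Proof. by move=> f_ge0; rewrite divr_ge0 ?sumr_ge0. Qed.

Lemma avg_le_cst T (x0 : T) (f : T -> R) c : (forall x, f x <= c) -> avg f <= c.
Proof. by move=> /ler_avg; rewrite (avg_cst x0). Qed.

Lemma avg_ge_cst T (x0 : T) (f : T -> R) c : (forall x, c <= f x) -> c <= avg f.
Proof. by move=> /ler_avg; rewrite (avg_cst x0). Qed.

Lemma exists_le_avg T (x0 : T) (f : T -> R) c : avg f <= c -> exists x, f x <= c.
Proof.
move=> fc; apply/existsP/contraT => /existsPn fgt.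
have T_gt0 : 0 < (#|T|%:R : R) by rewrite ltr0n; apply/card_gt0P; exists x0.
suff : c < avg f by rewrite ltNge fc.
rewrite -(avg_cst x0 c) ltr_pM2r ?invr_gt0//; apply: ltr_sum => [|x _].
  by apply/hasP; exists x0; rewrite ?mem_index_enum.
by rewrite ltNge.
Qed.

Lemma avg_markov T (x0 : T) (f : T -> R) c : (forall x, 0 <= f x) -> 0 < c ->
  1 - c^-1 <= \avg_x (f x <= c * avg f)%R%:R.
Proof.
move=> f_ge0 c_gt0; have := avg_ge0 f_ge0; rewrite le_eqVlt => /predU1P[f0|f_gt0].
  have T_neq0 : #|T|%:R != 0 :> R.
    by rewrite pnatr_eq0 -lt0n; apply/card_gt0P; exists x0.
  have /eqP : \sum_x f x = 0.
    by apply: (mulIf (invr_neq0 T_neq0)); rewrite mul0r.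
  rewrite psumr_eq0// => /allP fx0; apply: (avg_ge_cst x0) => x.
  rewrite -f0 mulr0 (eqP (fx0 x _)) ?mem_index_enum// lexx.
  by rewrite gerBl invr_ge0 ltW.
have cf_gt0 := mulr_gt0 c_gt0 f_gt0.
have tail x : 1 - f x / (c * avg f) <= (f x <= c * avg f)%R%:R.
  case: (leP (f x)) => [_|/ltW f_large]; first by rewrite gerBl divr_ge0// ltW.
  by rewrite subr_le0 ler_pdivlMr// mul1r.
apply: le_trans (ler_avg tail); rewrite avgB (avg_cst x0) avgMr.
by rewrite invfM mulrCA divff ?gt_eqF// mulr1.
Qed.

Section Fiber.
Context {T : finType} {U : eqType} (pi : T -> U).
Implicit Types (f : T -> R) (u : U).

Definition fiber_avg f u : R :=
  (\sum_(x | pi x == u) f x) / #|[pred x | pi x == u]|%:R.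

Lemma avg_fiber_avgM f (g : U -> R) :
  \avg_x (fiber_avg f (pi x) * g (pi x)) = \avg_x (f x * g (pi x)).
Proof.
rewrite /avg; congr (_ / _); rewrite /fiber_avg.
under eq_bigr => x _ do rewrite -mulrA mulr_suml big_mkcond.
rewrite exchange_big; apply: eq_bigr => y _; rewrite -big_mkcond /=.
under eq_bigl => x do rewrite eq_sym.
under eq_bigr => x /eqP -> do [].
rewrite -mulr_sumr sumr_const -[X in _ *+ X]/(#|[pred x | pi x == pi y]|).
rewrite -mulrnAl -mulr_natr mulVf ?mul1r//.
by rewrite pnatr_eq0 -lt0n; apply/card_gt0P; exists y; rewrite inE.
Qed.

Lemma fiber_avg_cst c x : fiber_avg (fun=> c) (pi x) = c.
Proof.
rewrite /fiber_avg sumr_const -[X in _ *+ X]/(#|[pred y | pi y == pi x]|).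
rewrite -[c *+ _]mulr_natr mulfK// pnatr_eq0 -lt0n.
by apply/card_gt0P; exists x; rewrite inE.
Qed.

Lemma fiber_avg_ge0 f u : (forall x, 0 <= f x) -> 0 <= fiber_avg f u.
Proof. by move=> f_ge0; rewrite divr_ge0 ?sumr_ge0. Qed.

Lemma fiber_avg_sum (I : finType) (f : T -> I -> R) u :
  \sum_i fiber_avg (f^~ i) u = fiber_avg (fun x => \sum_i f x i) u.
Proof. by rewrite /fiber_avg -mulr_suml exchange_big. Qed.

Lemma norm_fiber_avg_le1 f u :
  (forall x, `|f x| <= 1) -> `|fiber_avg f u| <= 1.
Proof.
move=> f_le1; rewrite /fiber_avg normf_div [`|_%:R|]ger0_norm//.
have [->|n_neq0] := eqVneq #|[pred x | pi x == u]| 0%N; first by rewrite invr0 mulr0.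
rewrite ler_pdivrMr ?mul1r ?ltr0n ?lt0n//.
apply: le_trans (ler_norm_sum _ _ _) _.
by rewrite -sum1_card natr_sum ler_sum.
Qed.

Lemma avg_sqr_sub_fiber_avg f :
  \avg_x (f x - fiber_avg f (pi x)) ^+ 2 =
  \avg_x f x ^+ 2 - \avg_x fiber_avg f (pi x) ^+ 2.
Proof.
have cross := avg_fiber_avgM f (fiber_avg f).
under eq_avg => x do
  rewrite sqrrB -[_ *+ 2]mulr_natl [fiber_avg _ _ ^+ 2]expr2.
by rewrite avgD avgB avgMl -cross; ring.
Qed.

End Fiber.

Section Splice.
Context {I A : finType}.
Implicit Types (X Y : {set I}) (f g h : {ffun I -> A}) (j : I).

Definition splice X f g : {ffun I -> A} := [ffun q => if q \in X then f q else g q].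

Definition set_at f j (a : A) : {ffun I -> A} := [ffun q => if q == j then a else f q].

Lemma splicexx X f : splice X f f = f.
Proof. by apply/ffunP => q; rewrite ffunE if_same. Qed.

Lemma spliceS X Y f g h : X \subset Y -> splice X (splice Y f g) h = splice X f h.
Proof.
move=> /fintype.subsetP XY; apply/ffunP => q; rewrite !ffunE.
by case: ifP => // /XY ->.
Qed.

Lemma splice_set_at X f g j a : j \notin X -> splice X (set_at f j a) g = splice X f g.
Proof.
move=> jX; apply/ffunP => q; rewrite !ffunE; case: ifP => // qX.
by rewrite ifN//; apply: contraNneq jX => <-.
Qed.

Lemma set_atxx f j : set_at f j (f j) = f.
Proof. by apply/ffunP => q; rewrite ffunE; case: eqP => [->|]. Qed.

Lemma avg_splice X (F : {ffun I -> A} -> R) : \avg_f \avg_g F (splice X f g) = avg F.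
Proof.
pose swap (p : {ffun I -> A} * {ffun I -> A}) :=
  (splice X p.1 p.2, splice X p.2 p.1).
have swapK : involutive swap.
  by move=> [f g]; congr pair; apply/ffunP => q; rewrite !ffunE; case: (q \in X).
have [T0|/card_gt0P[f0 _]] := posnP #|{ffun I -> A}|.
  by rewrite /avg T0 invr0 !mulr0.
rewrite pair_avg (reindex_avg _ (inv_bij swapK)).
rewrite (eq_avg (g := fun p => F p.1)) => [|p]; last by rewrite -[in RHS](swapK p).
by rewrite avg_pair; apply: eq_avg => f /=; rewrite (avg_cst f0).
Qed.

Lemma avg_set_at j (a0 : A) (F : {ffun I -> A} -> R) :
  \avg_a \avg_f F (set_at f j a) = avg F.
Proof.
pose swap (p : A * {ffun I -> A}) := (p.2 j, set_at p.2 j p.1).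
have swapK : involutive swap.
  move=> [a f]; congr pair; first by rewrite ffunE eqxx.
  by apply/ffunP => q; rewrite !ffunE; case: eqP => // ->.
rewrite pair_avg (reindex_avg _ (inv_bij swapK)).
rewrite (eq_avg (g := fun p => F p.2)) => [|p]; last by rewrite -[in RHS](swapK p).
by rewrite avg_pair /= (avg_cst a0).
Qed.

End Splice.
End Average.

(** * Conditional entropy *)

Section LogarithmBounds.
Context {R : realType}.
Implicit Type x : R.

Lemma ln_le_subr1 x : 0 < x -> ln x <= x - 1.
Proof. by move=> x_gt0; rewrite -{1}(subrKC 1 x) le_ln1Dx// ltrBrDr addNr. Qed.

Lemma ln_ge_subV x : 0 < x -> 1 - x^-1 <= ln x.
Proof.
move=> x_gt0; have := @ln_le_subr1 x^-1.
by rewrite invr_gt0 lnV ?posrE// => /(_ x_gt0); lra.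
Qed.

Lemma ln1D_ge_quadratic x : - (1 / 2) <= x -> x - 2 * x ^+ 2 <= ln (1 + x).
Proof.
move=> x_ge; have x1_gt0 : 0 < 1 + x by lra.
apply: le_trans (ln_ge_subV x1_gt0).
have -> : 1 - (1 + x)^-1 = x / (1 + x) by field; rewrite gt_eqF.
rewrite ler_pdivlMr// -subr_ge0.
have -> : x - (x - 2 * x ^+ 2) * (1 + x) = x ^+ 2 * (1 + 2 * x) by ring.
by rewrite mulr_ge0 ?sqr_ge0//; lra.
Qed.

Lemma ln2_ge : 1 / 2 <= ln 2 :> R.
Proof. by have := @ln_ge_subV 2 (ltr0Sn _ _); lra. Qed.

Lemma ln2_le : ln 2 <= 1 :> R.
Proof. by have := @ln_le_subr1 2 (ltr0Sn _ _); lra. Qed.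

End LogarithmBounds.

Section ConditionalEntropy.
Context {R : realType} {I A Q : finType} (V : {ffun I -> A} -> Q).
Implicit Types (X Y : {set I}) (f g : {ffun I -> A}) (v : Q).

Definition cond_prob X f v : R := \avg_g (V (splice X f g) == v)%:R.

Definition cond_entropy X : R := \avg_f - ln (cond_prob X f (V f)).

Lemma cond_prob_splice X Y f g v :
  X \subset Y -> cond_prob X (splice Y f g) v = cond_prob X f v.
Proof. by move=> XY; apply: eq_avg => h; rewrite spliceS. Qed.

Lemma cond_prob_gt0 X f : 0 < cond_prob X f (V f).
Proof.
rewrite divr_gt0 ?ltr0n//; last by apply/card_gt0P; exists f.
by rewrite (bigD1 f)//= splicexx eqxx ltr_wpDr// sumr_ge0.
Qed.

Lemma cond_prob_ge0 X f v : 0 <= cond_prob X f v.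
Proof. by apply: avg_ge0 => g; rewrite ler0n. Qed.

Lemma cond_prob_le1 X f v : cond_prob X f v <= 1.
Proof. by apply: (avg_le_cst f) => g; rewrite lern1 leq_b1. Qed.

Lemma avg_cond_prob X f (G : Q -> R) :
  \avg_g G (V (splice X f g)) = \sum_v cond_prob X f v * G v.
Proof.
under [RHS]eq_bigr => v _ do rewrite -avgMr.
rewrite -avg_sum; apply: eq_avg => g.
rewrite (bigD1 (V (splice X f g)))//= eqxx mul1r big1 ?addr0// => v.
by rewrite eq_sym => /negbTE->; rewrite mul0r.
Qed.

Lemma cond_entropy_ge0 X : 0 <= cond_entropy X.
Proof. by apply: avg_ge0 => f; rewrite oppr_ge0 ln_le0// cond_prob_le1. Qed.

Lemma avg_cond_probV_le X :
  \avg_f (cond_prob X f (V f))^-1 <= #|Q|%:R :> R.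
Proof.
have [T0|/card_gt0P[f0 _]] := posnP #|{ffun I -> A}|; first by rewrite /avg T0 invr0 mulr0.
rewrite -(avg_splice X); apply: (avg_le_cst f0) => f.
under eq_avg do rewrite cond_prob_splice//.
rewrite (avg_cond_prob X f (fun v => (cond_prob X f v)^-1)) -sumr_const.
apply: ler_sum => v _.
by have [->|n0] := eqVneq (cond_prob X f v) 0; rewrite ?mul0r// mulfV.
Qed.

Lemma cond_entropy_le X : cond_entropy X <= ln #|Q|%:R.
Proof.
have [T0|/card_gt0P[f0 _]] := posnP #|{ffun I -> A}|.
  rewrite /cond_entropy /avg T0 invr0 mulr0.
  by case: #|Q| => [|m]; [rewrite ln0 | rewrite ln_ge0// ler1n].
have Q_gt0 : 0 < (#|Q|%:R : R) by rewrite ltr0n; apply/card_gt0P; exists (V f0).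
have jensen f : - ln (cond_prob X f (V f)) <=
    (cond_prob X f (V f))^-1 / #|Q|%:R + (ln #|Q|%:R - 1).
  have p_gt0 := cond_prob_gt0 X f.
  have : ln ((cond_prob X f (V f))^-1 / #|Q|%:R) <= (cond_prob X f (V f))^-1 / #|Q|%:R - 1.
    by apply: ln_le_subr1; rewrite divr_gt0 ?invr_gt0.
  by rewrite ln_div ?posrE ?invr_gt0// lnV ?posrE//; lra.
apply: le_trans (ler_avg jensen) _; rewrite avgD (avg_cst f0) avgMr.
by have := avg_cond_probV_le X; rewrite -[leRHS]mul1r -ler_pdivrMr//; lra.
Qed.

Lemma cond_entropy_le_bits X S : (#|Q| <= 2 ^ S)%N -> cond_entropy X <= S%:R.
Proof.
move=> Q_le; apply: le_trans (cond_entropy_le X) _.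
case: #|Q| Q_le => [|m] Q_le; first by rewrite ln0.
apply: (@le_trans _ _ (ln (2 ^ S)%:R)).
  by rewrite ler_ln ?posrE ?ltr0n ?expn_gt0// ler_nat.
by rewrite natrX lnXn// -[leLHS]mulr_natl ler_piMr// ln2_le.
Qed.

(* Gibbs' inequality for the density [G f v * P(v | X) / P(v | Y)]. *)
Lemma cond_entropy_drop (f0 : {ffun I -> A}) X Y (G : {ffun I -> A} -> Q -> R) :
  X \subset Y -> (forall f v, 0 < G f v) ->
  (forall f g v, G (splice Y f g) v = G f v) ->
  \avg_f ln (G f (V f)) - \avg_f \avg_g G f (V (splice X f g)) + 1
  <= cond_entropy X - cond_entropy Y.
Proof.
move=> XY G_gt0 G_splice.
pose r f v := cond_prob X f v * G f v / cond_prob Y f v.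
have gibbs f : ln (G f (V f)) - r f (V f) + 1 <=
    - ln (cond_prob X f (V f)) - - ln (cond_prob Y f (V f)).
  have pX := cond_prob_gt0 X f; have pY := cond_prob_gt0 Y f.
  have : ln (r f (V f)) <= r f (V f) - 1.
    exact: ln_le_subr1 (divr_gt0 (mulr_gt0 pX (G_gt0 _ _)) pY).
  by rewrite {1}/r ln_div ?posrE ?(mulr_gt0 pX)// lnM ?posrE//; lra.
rewrite -[leRHS]avgB; apply: le_trans (ler_avg gibbs).
rewrite avgD (avg_cst f0) avgB lerD2r lerD2l lerN2.
rewrite -(avg_splice Y); apply: ler_avg => f.
under eq_avg => g do rewrite /r cond_prob_splice// G_splice cond_prob_splice// -/(r f _).
rewrite (avg_cond_prob Y f (r f)) (avg_cond_prob X f (G f)); apply: ler_sum => v _.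
rewrite /r; have [->|n0] := eqVneq (cond_prob Y f v) 0; last by rewrite mulrC divfK.
by rewrite mul0r mulr_ge0 ?cond_prob_ge0// ltW.
Qed.

Lemma cond_entropy_anti X Y : X \subset Y -> cond_entropy Y <= cond_entropy X.
Proof.
move=> XY; have [T0|/card_gt0P[f0 _]] := posnP #|{ffun I -> A}|.
  by rewrite /cond_entropy /avg T0 invr0 !mulr0.
have := @cond_entropy_drop f0 X Y (fun _ _ => 1) XY (fun _ _ => ltr01) (fun _ _ _ => erefl).
under [X in _ - X]eq_avg => f do rewrite (avg_cst f0).
by rewrite ln1 !(avg_cst f0); lra.
Qed.

End ConditionalEntropy.

(** * Random signs *)

Section RandomSigns.
Context {R : realFieldType} {I : finType}.
Local Notation bits := {ffun I -> bool}.
Implicit Types (b y : bits) (s : seq I) (J : {set I}) (c : I -> R).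

Lemma avg_flip j (F : bits -> R) : avg F = \avg_b F (set_at b j (~~ b j)).
Proof.
have flipK : involutive (fun b : bits => set_at b j (~~ b j)).
  move=> b; apply/ffunP => q; rewrite !ffunE eqxx negbK.
  by case: eqP => // ->.
exact: reindex_avg (inv_bij flipK).
Qed.

Lemma avg_odd j (F : bits -> R) : (forall b, F (set_at b j (~~ b j)) = - F b) -> avg F = 0.
Proof.
move=> F_odd; have := avg_flip j F; under [RHS]eq_avg => b do rewrite F_odd -mulN1r.
by rewrite avgMl; lra.
Qed.

Definition rademacher s c b : R := \sum_(j <- s) c j * (-1) ^+ b j.

Lemma rademacher_cons j s c b :
  rademacher (j :: s) c b = c j * (-1) ^+ b j + rademacher s c b.
Proof. exact: big_cons. Qed.

Lemma rademacher_set_at s c b j a :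
  j \notin s -> rademacher s c (set_at b j a) = rademacher s c b.
Proof.
move=> js; apply: eq_big_seq => q qs.
by rewrite ffunE ifN//; apply: contraNneq js => <-.
Qed.

Lemma avg_sign_rademacherX j s c k :
  j \notin s -> \avg_(b : bits) (-1) ^+ b j * rademacher s c b ^+ k = 0.
Proof.
move=> js; apply: (avg_odd (j := j)) => b.
by rewrite rademacher_set_at// ffunE eqxx signrN mulNr.
Qed.

Lemma avg_rademacher_sqr s c :
  uniq s -> \avg_b rademacher s c b ^+ 2 = \sum_(j <- s) c j ^+ 2.
Proof.
elim: s => [_|j s IH /= /andP[js s_uniq]].
  under eq_avg do rewrite /rademacher big_nil expr0n.
  by rewrite big_nil (avg_cst [ffun=> true]).
have expand b : rademacher (j :: s) c b ^+ 2 = c j ^+ 2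
    + 2 * c j * ((-1) ^+ b j * rademacher s c b ^+ 1) + rademacher s c b ^+ 2.
  by rewrite rademacher_cons; case: (b j); ring.
under eq_avg => b do rewrite expand.
rewrite avgD avgD avgMl avg_sign_rademacherX// mulr0 addr0 IH//.
by rewrite (avg_cst [ffun=> true]) big_cons.
Qed.

Lemma avg_rademacher_exp4 s c :
  uniq s -> \avg_b rademacher s c b ^+ 4 <= 3 * (\sum_(j <- s) c j ^+ 2) ^+ 2.
Proof.
elim: s => [_|j s IH /= /andP[js s_uniq]].
  under eq_avg do rewrite /rademacher big_nil expr0n.
  by rewrite big_nil (avg_cst [ffun=> true]) expr0n mulr0.
have expand b : rademacher (j :: s) c b ^+ 4 = c j ^+ 4
    + 6 * c j ^+ 2 * rademacher s c b ^+ 2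
    + 4 * c j ^+ 3 * ((-1) ^+ b j * rademacher s c b ^+ 1)
    + 4 * c j * ((-1) ^+ b j * rademacher s c b ^+ 3) + rademacher s c b ^+ 4.
  by rewrite rademacher_cons; case: (b j); ring.
under eq_avg => b do rewrite expand.
do 4 rewrite avgD; rewrite !avgMl !avg_sign_rademacherX// avg_rademacher_sqr//.
rewrite (avg_cst [ffun=> true]) big_cons.
have : 0 <= c j ^+ 4 by rewrite (exprM _ 2 2) sqr_ge0.
by move: (IH s_uniq); set x := \sum_(q <- s) _; lra.
Qed.

Definition correlation J b y : R := \sum_(j in J) (-1) ^+ b j * (-1) ^+ y j.

Lemma correlationE J b y :
  correlation J b y = rademacher (enum J) (fun j => (-1) ^+ b j) y.
Proof. by rewrite /rademacher big_enum. Qed.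

Lemma norm_correlation_le J b y : `|correlation J b y| <= #|J|%:R.
Proof.
apply: le_trans (ler_norm_sum _ _ _) _; rewrite -sumr_const ler_sum// => j _.
by rewrite normrM !normr_sign mulr1.
Qed.

Lemma correlation_hamming J b y :
  correlation J b y = #|J|%:R - 2 * (\sum_(j in J) (b j != y j))%N%:R.
Proof.
rewrite natr_sum mulr_sumr -sum1_card natr_sum -sumrB; apply: eq_bigr => j _.
by case: (b j); case: (y j); rewrite /=; ring.
Qed.

Lemma normr_le_AGM (a x : R) : 0 < a -> `|x| <= (a + x ^+ 2 / a) / 2.
Proof.
move=> a_gt0; rewrite -(ler_pM2l a_gt0).
apply: le_trans (leif_mean_square a `|x|).1 _.
rewrite real_normK ?num_real// mulrA [a * (_ + _)]mulrDr -expr2 mulrCA.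
by rewrite divff ?mulr1// gt_eqF.
Qed.

Lemma ler_avg_rademacher s c (o : bits -> R) (a : R) :
  uniq s -> (forall y, `|o y| <= 1) -> 0 < a ->
  \avg_y o y * rademacher s c y <= (a + (\sum_(j <- s) c j ^+ 2) / a) / 2.
Proof.
move=> s_uniq o_le1 a_gt0.
have pointwise y : o y * rademacher s c y <= (a + rademacher s c y ^+ 2 / a) / 2.
  apply: le_trans (normr_le_AGM _ a_gt0).
  by apply: le_trans (ler_norm _) _; rewrite normrM ler_piMl.
apply: le_trans (ler_avg pointwise) _.
by rewrite avgMr avgD avgMr (avg_cst [ffun=> true]) avg_rademacher_sqr.
Qed.

End RandomSigns.

Section Khintchine.
Context {R : rcfType} {I : finType}.
Implicit Types (b y : {ffun I -> bool}) (s : seq I) (J : {set I}) (c : I -> R).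

Lemma normr_ge_quartic (x : R) : x ^+ 2 - x ^+ 4 / 4 <= `|x|.
Proof.
rewrite -(real_normK (num_real x)) (exprM _ 2 2) -(real_normK (num_real x)).
have := normr_ge0 x; set z := `|x| => z_ge0.
have -> : z ^+ 2 - (z ^+ 2) ^+ 2 / 4 = z * (z - z ^+ 3 / 4) by field.
rewrite -[leRHS]mulr1 ler_wpM2l//.
have : 0 <= (z - 6 / 5) ^+ 2 * (z + 12 / 5) by rewrite mulr_ge0 ?sqr_ge0// addr_ge0.
have -> : (z - 6 / 5) ^+ 2 * (z + 12 / 5) = z ^+ 3 - 108 / 25 * z + 432 / 125 by field.
by lra.
Qed.

Lemma khintchine s c : uniq s ->
  Num.sqrt (\sum_(j <- s) c j ^+ 2) / 4 <= \avg_y `|rademacher s c y|.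
Proof.
move=> s_uniq; set v := \sum_(j <- s) _.
have v_ge0 : 0 <= v by apply: sumr_ge0 => j _; exact: sqr_ge0.
have [->|v_neq0] := eqVneq v 0; first by rewrite sqrtr0 mul0r avg_ge0.
set k := Num.sqrt v; have k_gt0 : 0 < k by rewrite sqrtr_gt0 lt0r v_neq0.
have vE : v = k ^+ 2 by rewrite sqr_sqrtr.
have quartic y : k^-1 * rademacher s c y ^+ 2 - (4 * k ^+ 3)^-1 * rademacher s c y ^+ 4
    <= `|rademacher s c y|.
  set x := rademacher s c y; have := normr_ge_quartic (x / k).
  rewrite -(ler_pM2l k_gt0) normf_div [`|k|]gtr0_norm// mulrCA mulfV ?gt_eqF// mulr1.
  rewrite (_ : k * _ = k^-1 * x ^+ 2 - (4 * k ^+ 3)^-1 * x ^+ 4)//.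
  by field; rewrite gt_eqF.
apply: le_trans (ler_avg quartic); rewrite avgB !avgMl avg_rademacher_sqr// -/v vE.
have := avg_rademacher_exp4 c s_uniq; rewrite -/v vE => fourth.
have : (4 * k ^+ 3)^-1 * (\avg_y rademacher s c y ^+ 4) <= 3 / 4 * k.
  have -> : 3 / 4 * k = (4 * k ^+ 3)^-1 * (3 * (k ^+ 2) ^+ 2) by field; rewrite gt_eqF.
  by rewrite ler_wpM2l// invr_ge0 mulr_ge0// exprn_ge0// ltW.
have -> : k^-1 * k ^+ 2 = k by field; rewrite gt_eqF.
by lra.
Qed.

Lemma avg_norm_correlation_ge J :
  Num.sqrt #|J|%:R / 4 <= \avg_b \avg_y `|correlation J b y| :> R.
Proof.
apply: (avg_ge_cst [ffun=> true]) => b; under eq_avg => y do rewrite correlationE.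
have -> : #|J|%:R = \sum_(j <- enum J) ((-1) ^+ b j) ^+ 2 :> R.
  by under eq_bigr => j _ do rewrite sqrr_sign; rewrite big_enum sumr_const.
exact: khintchine (enum_uniq _).
Qed.

End Khintchine.

Section Bias.
Context {R : realFieldType} {I T : finType} {U : eqType}.
Local Notation bits := {ffun I -> bool}.
Variables (msg : T -> U) (bits_of : T -> bits).

Definition bias j (u : U) : R := fiber_avg msg (fun t => (-1) ^+ bits_of t j) u.

Lemma norm_bias_le1 j u : `|bias j u| <= 1.
Proof. by apply: norm_fiber_avg_le1 => t; rewrite normr_sign. Qed.

Lemma avg_sign_bias j (g : U -> R) :
  \avg_t (-1) ^+ bits_of t j * g (msg t) = \avg_t bias j (msg t) * g (msg t).
Proof. by rewrite avg_fiber_avgM. Qed.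

Lemma avg_correlation_bias (o : U -> bits -> R) (J : {set I}) :
  \avg_t \avg_y o (msg t) y * correlation J (bits_of t) y =
  \avg_t \avg_y o (msg t) y * rademacher (enum J) (bias^~ (msg t)) y.
Proof.
rewrite [LHS]exchange_avg [RHS]exchange_avg; apply: eq_avg => y.
under eq_avg => t do rewrite mulr_sumr.
under [RHS]eq_avg => t do rewrite /rademacher mulr_sumr.
rewrite !avg_sum big_enum; apply: eq_bigr => j _.
under eq_avg => t do rewrite mulrCA.
under [RHS]eq_avg => t do rewrite mulrCA.
by rewrite (avg_sign_bias j (fun u => o u y * (-1) ^+ y j)).
Qed.

Lemma sum_sqr_bias_ge (t0 : T) (o : U -> bits -> R) (J : {set I}) (a : R) :
  (forall u y, `|o u y| <= 1) -> 0 < a ->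
  a <= \avg_t \avg_y o (msg t) y * correlation J (bits_of t) y ->
  a ^+ 2 <= \sum_(j in J) \avg_t bias j (msg t) ^+ 2.
Proof.
move=> o_le1 a_gt0; rewrite avg_correlation_bias => a_le.
have bound t := ler_avg_rademacher (bias^~ (msg t)) (enum_uniq J) (o_le1 (msg t)) a_gt0.
have := le_trans a_le (ler_avg bound).
under eq_avg => t do rewrite big_enum.
rewrite avgMr avgD avgMr (avg_cst t0) avg_sum; set E := \sum_(j in J) _ => a_le_half.
suff : a <= E / a by rewrite ler_pdivlMr// expr2.
by lra.
Qed.

End Bias.

(** * Recurrence and approximate periods *)

Section L1Distance.
Context {R : realFieldType} {Q : finType}.
Implicit Types p q : Q -> R.

Definition l1_dist p q : R := \sum_o `|p o - q o|.

Lemma l1_dist_ge0 p q : 0 <= l1_dist p q.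
Proof. exact: sumr_ge0. Qed.

Lemma l1_distxx p : l1_dist p p = 0.
Proof. by apply: big1 => o _; rewrite subrr normr0. Qed.

Lemma l1_distC p q : l1_dist p q = l1_dist q p.
Proof. by apply: eq_bigr => o _; rewrite distrC. Qed.

Lemma l1_dist_triangle p q p' : l1_dist p p' <= l1_dist p q + l1_dist q p'.
Proof. by rewrite -big_split; apply: ler_sum => o _; exact: ler_distD. Qed.

Lemma l1_dist_le_norms p q : l1_dist p q <= \sum_o `|p o| + \sum_o `|q o|.
Proof. by rewrite -big_split; apply: ler_sum => o _; exact: ler_normB. Qed.

Lemma l1_dist_test p q (chi : Q -> R) c : (forall o, `|chi o| <= c) ->
  `|\sum_o p o * chi o - \sum_o q o * chi o| <= c * l1_dist p q.
Proof.
move=> chi_le; rewrite -sumrB mulr_sumr; apply: le_trans (ler_norm_sum _ _ _) _.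
by apply: ler_sum => o _; rewrite -mulrBl normrM mulrC ler_wpM2r.
Qed.

Lemma l1_dist_le_sqr p q c : 0 < c ->
  l1_dist p q <= (#|Q|%:R * c + (\sum_o (p o - q o) ^+ 2) / c) / 2.
Proof.
move=> c_gt0; apply: le_trans (ler_sum _ (fun o _ => normr_le_AGM _ c_gt0)) _.
by rewrite -mulr_suml big_split -mulr_suml sumr_const mulr_natl.
Qed.

End L1Distance.

Section IntervalSums.
Context {R : realFieldType}.
Implicit Types (F : nat -> R) (a b c d m n : nat).

Lemma ler_sum_nat_widen F a b c d : (forall n, 0 <= F n) -> (a <= b)%N -> (c <= d)%N ->
  \sum_(b <= n < c) F n <= \sum_(a <= n < d) F n.
Proof.
move=> F_ge0 ab cd; have [bc|cb] := leqP b c; last by rewrite big_geq 1?ltnW// sumr_ge0.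
rewrite (@big_cat_nat _ _ _ b a d)//=; last exact: leq_trans cd.
by rewrite (@big_cat_nat _ _ _ c b d)//= addrCA lerDl addr_ge0// sumr_ge0.
Qed.

Lemma sum_nat_addl F a n : \sum_(a <= i < a + n) F i = \sum_(0 <= i < n) F (a + i)%N.
Proof. by rewrite -{1}[a]add0n big_addn addKn; apply: eq_bigr => i _; rewrite addnC. Qed.

Lemma sum_nat_le_cst F a b (x : R) :
  (forall n, F n <= x) -> \sum_(a <= n < b) F n <= x * (b - a)%:R.
Proof.
move=> F_le; apply: le_trans (ler_sum _ (fun n _ => F_le n)) _.
by rewrite sumr_const_nat mulr_natr.
Qed.

Lemma sum_shift_le F n d : (forall i, `|F i| <= 1) ->
  \sum_(0 <= i < n) (F i - F (i + d)%N) <= 2 * d%:R.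
Proof.
move=> F_le1; elim: d => [|d IH].
  by rewrite big1 ?mulr0// => i _; rewrite addn0 subrr.
have step i : F i - F (i + d.+1)%N = F i - F (i + d)%N - (F (i.+1 + d)%N - F (i + d)%N).
  by rewrite addnS addSn; ring.
under eq_bigr => i _ do rewrite step.
rewrite sumrB (telescope_sumr (fun i => F (i + d)%N))// add0n.
rewrite -[d.+1%:R]natr1 mulrDr mulr1 lerD//.
by have := F_le1 (n + d)%N; have := F_le1 d; rewrite !ler_norml; lra.
Qed.

End IntervalSums.

Lemma card_spread_set (T N : nat) (G : {set 'I_T}) :
  {in G &, forall a a' : 'I_T, (a < a')%N -> (a + N < a')%N} ->
  (#|G| <= (T %/ N.+1).+1)%N.
Proof.
move=> spread; pose slot (a : 'I_T) : 'I_(T %/ N.+1).+1 := inord (a %/ N.+1).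
have slotE a : slot a = (a %/ N.+1)%N :> nat by rewrite inordK// ltnS leq_div2r// ltnW.
rewrite -[leqRHS]card_ord -(@card_in_imset _ _ slot G) ?max_card// => a a' aG a'G.
move=> /(congr1 val) /=; rewrite !slotE => same; apply: val_inj => /=.
have := divn_eq a N.+1; have := divn_eq a' N.+1; rewrite same.
have := ltn_pmod a' (ltn0Sn N); have := ltn_pmod a (ltn0Sn N).
case: (ltngtP a a') => // lt; first by have := spread a a' aG a'G lt; lia.
by have := spread a' a a'G aG lt; lia.
Qed.

(* Two counters [a] and [m], read one after the other, drive a machine through
   the state [mid a y1] to the law [end_law (mid a y1) m y2]; [mean_law (a + m)]
   is what an observer of the sum alone predicts. If the prediction is good and
   some state recurs within [N] steps, then [mean_law] nearly has a period
   dividing [N`!]: the recurrence shifts it by some [d <= N], and adding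
   multiples of the exact period of [mid] turns multiples of [d] into [N`!]. *)
Section ApproximatePeriod.
Context {R : realFieldType} {Q H1 H2 : finType} (h1 : H1) (h2 : H2).
Variables (M N T2 : nat) (mid : nat -> H1 -> Q).
Variables (end_law : Q -> nat -> H2 -> Q -> R) (mean_law : nat -> Q -> R).

Local Notation shift := (N`!).
Local Notation T1 := ((N`!).*2).

Definition prediction_error a y1 : R :=
  \avg_(m : 'I_T2) \avg_y2 l1_dist (end_law (mid a y1) m y2) (mean_law (a + m)).

Definition mean_error : R := \avg_(a : 'I_T1) \avg_y1 prediction_error a y1.

Definition well_predicted a y1 := prediction_error a y1 <= 4 * mean_error.

Definition good_visit s a := [exists y1, (mid a y1 == s) && well_predicted a y1].

Definition near_return := [exists a : 'I_T1, exists a' : 'I_T1, exists s,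
  (a < a' <= a + N)%N && (good_visit s a && good_visit s a')].

Definition law_dist n n' := l1_dist (mean_law n) (mean_law n').

Definition drift d c := \sum_(T1 <= n < T2 - c) law_dist n (n + d).

Let shift_gt0 : (0 < shift)%N. Proof. exact: fact_gt0. Qed.
Let T1E : T1 = (shift + shift)%N. Proof. by rewrite addnn. Qed.
Let T1_gt0 : (0 < T1)%N. Proof. by rewrite double_gt0. Qed.
Let law_dist_ge0 n n' : 0 <= law_dist n n'. Proof. exact: l1_dist_ge0. Qed.

Lemma prediction_error_ge0 a y1 : 0 <= prediction_error a y1.
Proof. by do 2 (apply: avg_ge0 => ?); exact: l1_dist_ge0. Qed.

Lemma mean_error_ge0 : 0 <= mean_error.
Proof. by do 2 (apply: avg_ge0 => ?); exact: prediction_error_ge0. Qed.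

Lemma avg_well_predicted_ge :
  3 / 4 <= \avg_(a : 'I_T1) \avg_y1 (well_predicted a y1)%:R :> R.
Proof.
rewrite pair_avg; have -> : 3 / 4 = 1 - 4^-1 :> R by field.
rewrite /well_predicted /mean_error pair_avg.
apply: (avg_markov (Ordinal T1_gt0, h1)) => // p.
exact: prediction_error_ge0.
Qed.

Lemma good_visits_sparse s : ~~ near_return ->
  N%:R * (\avg_(a : 'I_T1) (good_visit s a)%:R) <= 2 :> R.
Proof.
move=> no_return; pose G := [set a : 'I_T1 | good_visit s a]%SET.
have G_le : (#|G| <= (T1 %/ N.+1).+1)%N.
  apply: card_spread_set => a a'; rewrite !inE => va va' lt.
  rewrite ltnNge; apply: contra no_return => le.
  apply/existsP; exists a; apply/existsP; exists a'; apply/existsP; exists s.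
  by rewrite lt le va va'.
have N_le : (N <= T1)%N by rewrite T1E; apply: leq_trans (leq_addr _ _); exact: fact_geq.
have : (N * #|G| <= 2 * T1)%N by have := leq_divM T1 N.+1; move: G_le N_le; nia.
rewrite /avg card_ord -natr_sum mulrA ler_pdivrMr ?ltr0n// -natrM -(natrM _ 2) ler_nat.
suff -> : (\sum_(a : 'I_T1) good_visit s a = #|G|)%N by [].
by rewrite -sum1_card [RHS]big_mkcond; apply: eq_bigr => a _; rewrite inE; case: good_visit.
Qed.

Section LongSecondPhase.
Hypothesis T2_gt0 : (0 < T2)%N.

Lemma same_state_law_dist a y a' y' : mid a y = mid a' y' ->
  \sum_(0 <= m < T2) law_dist (a + m) (a' + m)
  <= T2%:R * (prediction_error a y + prediction_error a' y').
Proof.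
move=> same; rewrite big_mkord -avgD {1}/avg card_ord mulrC divfK ?pnatr_eq0 -?lt0n//.
apply: ler_sum => m _; rewrite -avgD; apply: (avg_ge_cst h2) => y2.
by rewrite same [X in X + _]l1_distC; exact: l1_dist_triangle.
Qed.

Lemma drift_same_state a d y y' : (a < T1)%N -> mid a y = mid (a + d) y' ->
  drift d 0 <= T2%:R * (prediction_error a y + prediction_error (a + d) y').
Proof.
move=> a_lt same; apply: le_trans (same_state_law_dist same).
have -> : \sum_(0 <= m < T2) law_dist (a + m) (a + d + m) =
    \sum_(a <= n < a + T2) law_dist n (n + d).
  by rewrite sum_nat_addl; apply: eq_bigr => n _; rewrite addnAC.
by apply: ler_sum_nat_widen => //; lia.
Qed.

Lemma driftD d1 d2 c : (d1 <= c)%N -> drift (d1 + d2) c <= drift d1 c + drift d2 0.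
Proof.
move=> d1c.
apply: (@le_trans _ _ (drift d1 c +
  \sum_(T1 <= n < T2 - c) law_dist (n + d1) (n + d1 + d2))).
  by rewrite -big_split; apply: ler_sum => n _; rewrite addnA; exact: l1_dist_triangle.
rewrite lerD2l /drift.
have -> : \sum_(T1 <= n < T2 - c) law_dist (n + d1) (n + d1 + d2) =
    \sum_(T1 + d1 <= n < T2 - c + d1) law_dist n (n + d2).
  by rewrite big_addn addnK.
have [?|?] := leqP c T2; first by apply: ler_sum_nat_widen => //; lia.
by rewrite big_geq ?sumr_ge0//; lia.
Qed.

Lemma driftM q d c : (q * d <= c)%N -> drift (q * d) c <= q%:R * drift d 0.
Proof.
elim: q => [|q IH] qdc.
  by rewrite mul0n mul0r /drift big1// => n _; rewrite addn0 /law_dist l1_distxx.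
rewrite mulSn addnC; apply: le_trans (driftD _ _) _; first lia.
by rewrite -[q.+1%:R]natr1 mulrDl mul1r lerD2r IH//; lia.
Qed.

Hypothesis mid_periodic : forall y, exists lam,
  (0 < lam <= M)%N /\ forall a, mid (a + lam) y = mid a y.

Lemma exists_small_prediction_errors y e : (e <= shift)%N ->
  \avg_(a : 'I_T1) prediction_error a y <= mean_error ->
  exists2 a, (a < shift)%N &
    prediction_error a y + prediction_error (a + e) y <= 4 * mean_error.
Proof.
move=> e_le; rewrite {1}/avg card_ord ler_pdivrMr ?ltr0n// => total.
suff [a a_le] : exists a : 'I_shift,
    prediction_error a y + prediction_error (a + e) y <= 4 * mean_error by exists a.
apply: (exists_le_avg (Ordinal shift_gt0)).
rewrite avgD /avg card_ord -mulrDl ler_pdivrMr ?ltr0n//.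
have window c : (c <= shift)%N ->
    \sum_(i < shift) prediction_error (i + c) y <= mean_error * T1%:R.
  move=> c_le; apply: le_trans total.
  rewrite -(big_mkord xpredT (fun i => prediction_error (i + c) y)).
  rewrite -[leRHS](big_mkord xpredT (fun i => prediction_error i y)).
  have -> : \sum_(0 <= i < shift) prediction_error (i + c) y =
      \sum_(c <= i < shift + c) prediction_error i y.
    by rewrite -{2}[c]add0n big_addn addnK.
  apply: ler_sum_nat_widen => [n||]; first exact: prediction_error_ge0.
    by [].
  by rewrite T1E; lia.
have := lerD (window 0%N (leq0n _)) (window e e_le).
under [X in X + _ <= _ -> _]eq_bigr => i _ do rewrite addn0.
by move=> /le_trans; apply; rewrite T1E natrD; lra.
Qed.

Lemma drift_period_multiples : exists2 lam, (0 < lam <= M)%N &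
  forall q, (q * lam <= shift)%N -> drift (q * lam) 0 <= T2%:R * (4 * mean_error).
Proof.
have [y y_le] : exists y, \avg_(a : 'I_T1) prediction_error a y <= mean_error.
  by apply: (exists_le_avg h1); rewrite exchange_avg.
have [lam [lam_bd period]] := mid_periodic y; exists lam => // q q_le.
have periodq a : mid (a + q * lam) y = mid a y.
  by elim: q {q_le} => [|q IH]; rewrite ?addn0// mulSn addnCA addnC period.
have [a a_lt a_le] := exists_small_prediction_errors q_le y_le.
apply: le_trans (@drift_same_state a (q * lam) y y _ _) _ => //; last by rewrite ler_wpM2l.
by rewrite T1E; lia.
Qed.

Lemma drift_near_return : near_return ->
  exists2 d, (0 < d <= N)%N & drift d 0 <= T2%:R * (8 * mean_error).
Proof.
move=> /existsP[a /existsP[a' /existsP[s /andP[/andP[aa' a'N]]]]].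
move=> /andP[/existsP[y /andP[/eqP mid_a err_a]] /existsP[y' /andP[/eqP mid_a' err_a']]].
have a'E : (a + (a' - a))%N = a' by lia.
exists (a' - a)%N; first by lia.
apply: le_trans (@drift_same_state a _ y y' (ltn_ord a) _) _.
  by rewrite a'E mid_a mid_a'.
by rewrite ler_wpM2l// a'E; move: err_a err_a'; rewrite /well_predicted; lra.
Qed.

(* With [q := N`! / d], the shift splits as
   [N`! = (q %/ lam * d) * lam + (q %% lam) * d]. *)
Lemma drift_shift : near_return ->
  drift shift shift <= T2%:R * ((8 * M%:R + 4) * mean_error).
Proof.
move=> /drift_near_return[d d_bd drift_d].
have [lam /andP[lam_gt0 lam_le] drift_lam] := drift_period_multiples.
have d_dvd : (d %| shift)%N by apply: dvdn_fact.
have := divn_eq (shift %/ d) lam; set q := (shift %/ d)%N => qE.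
have shiftE : shift = ((q %/ lam * d) * lam + (q %% lam) * d)%N.
  by rewrite -[LHS](divnK d_dvd) -/q {1}qE; lia.
have r_le : ((q %% lam) * d <= shift)%N by rewrite [leqRHS]shiftE leq_addl.
have l_le : ((q %/ lam * d) * lam <= shift)%N by rewrite [leqRHS]shiftE leq_addr.
rewrite {1}shiftE addnC; apply: le_trans (driftD _ r_le) _.
have remainder : drift ((q %% lam) * d) shift <= M%:R * (T2%:R * (8 * mean_error)).
  apply: le_trans (driftM r_le) _; apply: ler_pM => //; first exact: sumr_ge0.
  by rewrite ler_nat; have := ltn_pmod q lam_gt0; lia.
by have := lerD remainder (drift_lam _ l_le); lra.
Qed.

Hypothesis mean_law_le1 : forall n, \sum_o `|mean_law n o| <= 1.

Lemma law_dist_le2 n n' : law_dist n n' <= 2.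
Proof.
apply: le_trans (l1_dist_le_norms _ _) _.
by have := mean_law_le1 n; have := mean_law_le1 n'; lra.
Qed.

Lemma window_law_dist_le a : (a < T1)%N ->
  \sum_(0 <= m < T2) law_dist (a + m) (a + m + shift) <= drift shift shift + 6 * shift%:R.
Proof.
move=> a_lt; rewrite -(sum_nat_addl (fun n => law_dist n (n + shift))).
have short b c : \sum_(b <= n < c) law_dist n (n + shift) <= 2 * (c - b)%:R.
  by apply: sum_nat_le_cst => n; exact: law_dist_le2.
have [T1_le|T1_gt] := leqP T1 (T2 - shift); last first.
  apply: le_trans (short _ _) _; apply: (@le_trans _ _ (6 * shift%:R)).
    by rewrite -!natrM ler_nat; lia.
  by rewrite lerDr sumr_ge0.
rewrite (@big_cat_nat _ _ _ T1 a (a + T2))/=; [|lia|lia].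
rewrite (@big_cat_nat _ _ _ (T2 - shift)%N T1 (a + T2))/=; [|lia|lia].
rewrite -/(drift shift shift) addrCA lerD2l.
apply: le_trans (lerD (short _ _) (short _ _)) _.
by rewrite -!natrM -natrD ler_nat; lia.
Qed.

Variable chi : Q -> nat -> R.
Hypothesis chi_le1 : forall o n, `|chi o n| <= 1.

Lemma mean_test_step n :
  \sum_o mean_law n o * (chi o n - chi o (n + shift)) <=
  (\sum_o mean_law n o * chi o n - \sum_o mean_law (n + shift) o * chi o (n + shift)%N)
  + law_dist n (n + shift).
Proof.
under eq_bigr => o _ do rewrite mulrBr.
rewrite sumrB -addrA lerD2l -lerBlDl opprK addrC.
have := l1_dist_test (mean_law (n + shift)) (mean_law n) (chi_le1 ^~ (n + shift)%N).
by rewrite mul1r l1_distC; apply: le_trans; exact: ler_norm.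
Qed.

Lemma avg_mean_test_shift_le a : (a < T1)%N -> near_return ->
  \avg_(m : 'I_T2) \sum_o mean_law (a + m) o * (chi o (a + m)%N - chi o (a + m + shift)%N)
  <= (8 * M%:R + 4) * mean_error + 8 * shift%:R / T2%:R.
Proof.
move=> a_lt returns; have T2_gt0' : 0 < T2%:R :> R by rewrite ltr0n.
pose test n := \sum_o mean_law n o * chi o n.
have test_le1 n : `|test n| <= 1.
  apply: le_trans (mean_law_le1 n); apply: le_trans (ler_norm_sum _ _ _) _.
  by apply: ler_sum => o _; rewrite normrM ler_piMr.
rewrite /avg card_ord ler_pdivrMr// mulrDl divfK ?gt_eqF//.
rewrite -(big_mkord xpredT (fun m =>
  \sum_o mean_law (a + m) o * (chi o (a + m)%N - chi o (a + m + shift)%N))).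
apply: le_trans (ler_sum _ (fun m _ => mean_test_step (a + m))) _; rewrite big_split /=.
have telescope :
    \sum_(0 <= m < T2) (test (a + m)%N - test (a + m + shift)%N) <= 2 * shift%:R.
  under eq_bigr => m _ do rewrite -addnA.
  by apply: (sum_shift_le (F := fun m => test (a + m)%N)).
have := window_law_dist_le a_lt; have := drift_shift returns.
by move: telescope; rewrite /test [T2%:R * _]mulrC; lra.
Qed.

Lemma shift_unnoticed : near_return ->
  \avg_(a : 'I_T1) \avg_y1 \avg_(m : 'I_T2) \avg_y2
    \sum_o end_law (mid a y1) m y2 o * (chi o (a + m)%N - chi o (a + m + shift)%N)
  <= (8 * M%:R + 6) * mean_error + 8 * shift%:R / T2%:R.
Proof.
move=> returns; pose delta n o := chi o n - chi o (n + shift)%N.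
have delta_le2 n o : `|delta n o| <= 2.
  apply: le_trans (ler_normB _ _) _.
  by have := chi_le1 o n; have := chi_le1 o (n + shift)%N; lra.
have predict a y1 m y2 : \sum_o end_law (mid a y1) m y2 o * delta (a + m)%N o <=
    \sum_o mean_law (a + m) o * delta (a + m)%N o
    + 2 * l1_dist (end_law (mid a y1) m y2) (mean_law (a + m)).
  by rewrite -lerBlDl; apply: le_trans (ler_norm _) (l1_dist_test _ _ (delta_le2 _)).
have average (a : 'I_T1) y1 :
    \avg_(m : 'I_T2) \avg_y2 \sum_o end_law (mid a y1) m y2 o * delta (a + m)%N o
    <= (8 * M%:R + 4) * mean_error + 8 * shift%:R / T2%:R + 2 * prediction_error a y1.
  apply: le_trans (ler_avg (fun m : 'I_T2 => ler_avg (predict a y1 m))) _.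
  under eq_avg => m do rewrite avgD (avg_cst h2) avgMl.
  by rewrite avgD avgMl lerD2r avg_mean_test_shift_le.
apply: le_trans (ler_avg (fun a : 'I_T1 => ler_avg (average a))) _.
under eq_avg => a do rewrite avgD (avg_cst h1) avgMl.
by rewrite avgD (avg_cst (Ordinal T1_gt0)) avgMl -/mean_error; lra.
Qed.

End LongSecondPhase.
End ApproximatePeriod.

(** * Many rounds of random counts *)

Section Rounds.
Context {Q Omega : finType} (step : Q -> Omega -> Q).

Fixpoint rounds (t : nat) : finType :=
  if t is t'.+1 then (Omega * rounds t')%type else unit.

Fixpoint run t : Q -> rounds t -> Q :=
  if t is t'.+1 then fun s p => run (step s p.1) p.2 else fun s _ => s.

Fixpoint constant_rounds (w : Omega) t : rounds t :=
  if t is t'.+1 then (w, constant_rounds w t') else tt.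

Section RunAverage.
Context {R : realFieldType}.
Implicit Types (f g h : Q -> R) (s : Q).

Definition run_avg t g s : R := \avg_(p : rounds t) g (run s p).

Lemma run_avgS t g s : run_avg t.+1 g s = \avg_w run_avg t g (step s w).
Proof. by rewrite /run_avg avg_pair. Qed.

Lemma run_avgSr t g s : run_avg t.+1 g s = run_avg t (fun s' => \avg_w g (step s' w)) s.
Proof.
elim: t s => [|t IH] s.
  by rewrite run_avgS [RHS]avg_unit; apply: eq_avg => w; exact: avg_unit.
by rewrite run_avgS [RHS]run_avgS; apply: eq_avg => w.
Qed.

Lemma run_avg_le_affine (w0 : Omega) t f g h (a b c d : R) s :
  (forall s', f s' * a <= b + c * g s' + h s' * d) ->
  run_avg t f s * a <= b + c * run_avg t g s + run_avg t h s * d.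
Proof.
move=> fgh; have := ler_avg (fun p : rounds t => fgh (run s p)).
by rewrite avgMr avgD avgD (avg_cst (constant_rounds w0 t)) avgMl avgMr.
Qed.

End RunAverage.

Section FinalLaw.
Context {R : realFieldType} {U : eqType} (rev : Omega -> U).

Fixpoint revealed t : rounds t -> seq U :=
  if t is t'.+1 then fun p => rev p.1 :: revealed p.2 else fun=> [::].

Fixpoint final_law t : rounds t -> Q -> Q -> R :=
  if t is t'.+1
  then fun p s o => fiber_avg rev (fun w => final_law p.2 (step s w) o) (rev p.1)
  else fun _ s o => (s == o)%:R.

Definition predicted_law t (p : rounds t) s u o : R :=
  fiber_avg rev (fun w => final_law p (step s w) o) u.

Lemma final_law_ge0 t (p : rounds t) s o : 0 <= final_law p s o.
Proof.
elim: t p s => [|t IH] p s /=; first by rewrite ler0n.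
exact: fiber_avg_ge0.
Qed.

Lemma sum_indicM s (F : Q -> R) : \sum_o (s == o)%:R * F o = F s.
Proof.
rewrite (bigD1 s)//= eqxx mul1r big1 ?addr0// => o.
by rewrite eq_sym => /negbTE->; rewrite mul0r.
Qed.

Lemma final_law_sum t (p : rounds t) s : \sum_o final_law p s o = 1.
Proof.
elim: t p s => [|t IH] p s /=.
  by under eq_bigr do rewrite -[_%:R]mulr1; rewrite sum_indicM.
rewrite (fiber_avg_sum rev (fun w => final_law p.2 (step s w))) /fiber_avg.
under eq_bigr => w _ do rewrite IH.
exact: fiber_avg_cst.
Qed.

Lemma predicted_law_le1 t (p : rounds t) s u : \sum_o `|predicted_law p s u o| <= 1.
Proof.
under eq_bigr => o _.
  rewrite ger0_norm; last by apply: fiber_avg_ge0 => w; exact: final_law_ge0.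
  over.
rewrite fiber_avg_sum; apply: le_trans (ler_norm _) _.
by apply: norm_fiber_avg_le1 => w; rewrite final_law_sum normr1.
Qed.

Lemma avg_run t s (psi : seq U -> Q -> R) :
  \avg_(p : rounds t) psi (revealed p) (run s p) =
  \avg_(p : rounds t) \sum_o final_law p s o * psi (revealed p) o.
Proof.
elim: t s psi => [|t IH] s psi /=; first by apply: eq_avg => p; rewrite sum_indicM.
rewrite [LHS]avg_pair [RHS]avg_pair /=.
under eq_avg => w do rewrite (IH (step s w) (fun l => psi (rev w :: l))).
rewrite [LHS]exchange_avg [RHS]exchange_avg; apply: eq_avg => p.
rewrite !avg_sum; apply: eq_bigr => o _.
by rewrite (avg_fiber_avgM rev _ (fun u => psi (u :: revealed p) o)).
Qed.

Definition energy t s : R := \avg_(p : rounds t) \sum_o final_law p s o ^+ 2.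

Definition forgetting t s : R := \avg_(p : rounds t) \avg_w
  \sum_o (final_law p (step s w) o - predicted_law p s (rev w) o) ^+ 2.

Definition forgetting_l1 t s : R := \avg_(p : rounds t) \avg_w
  l1_dist (final_law p (step s w)) (predicted_law p s (rev w)).

Lemma energy_ge0 t s : 0 <= energy t s.
Proof. by apply: avg_ge0 => p; apply: sumr_ge0 => o _; exact: sqr_ge0. Qed.

Lemma energy0 s : energy 0 s = 1.
Proof.
rewrite /energy avg_unit; under eq_bigr do rewrite expr2.
by rewrite sum_indicM /= eqxx.
Qed.

Lemma forgettingE t s : forgetting t s = (\avg_w energy t (step s w)) - energy t.+1 s.
Proof.
rewrite /energy [X in _ - X]avg_pair /=.
rewrite [X in X - _]exchange_avg [X in _ - X]exchange_avg -avgB.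
apply: eq_avg => p; rewrite !avg_sum -sumrB; apply: eq_bigr => o _.
exact: avg_sqr_sub_fiber_avg.
Qed.

(* Telescoping: revealing one more round lowers the energy, which stays in [0, 1]. *)
Lemma sum_forgetting_le1 (w0 : Omega) tau s :
  \sum_(r < tau) run_avg r (forgetting (tau.-1 - r)) s <= 1.
Proof.
pose level r := run_avg r (energy (tau - r)) s.
rewrite -(big_mkord xpredT (fun r => run_avg r (forgetting (tau.-1 - r)) s)).
rewrite (@telescope_sumr_eq _ 0 tau level)// => [|r /andP[_ r_lt]]; last first.
  rewrite /level run_avgSr -avgB; apply: eq_avg => p.
  have -> : (tau - r = (tau.-1 - r).+1)%N by lia.
  by rewrite forgettingE (_ : (tau - r.+1)%N = (tau.-1 - r)%N)//; lia.
have level0 : 0 <= level 0%N by apply: avg_ge0 => p; exact: energy_ge0.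
have -> : level tau = 1.
  rewrite /level subnn /run_avg; under eq_avg do rewrite energy0.
  exact: avg_cst (constant_rounds w0 tau) _.
by lra.
Qed.

Lemma forgetting_l1_le (w0 : Omega) t s c : 0 < c ->
  forgetting_l1 t s <= (#|Q|%:R * c + forgetting t s / c) / 2.
Proof.
move=> c_gt0; apply: le_trans (ler_avg (fun p : rounds t =>
  ler_avg (fun w => l1_dist_le_sqr _ _ c_gt0))) _.
under eq_avg => p do rewrite avgMr avgD (avg_cst w0) avgMr.
by rewrite avgMr avgD (avg_cst (constant_rounds w0 t)) avgMr.
Qed.

End FinalLaw.
End Rounds.
Arguments rounds : clear implicits.

Lemma iter_eventually_periodic (Q : finType) (f : Q -> Q) (s : Q) :
  exists2 lam, (0 < lam <= #|Q|)%N &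
    forall n, (#|Q| <= n)%N -> iter (n + lam) f s = iter n f s.
Proof.
have : looping f s #|Q|.
  rewrite -[looping _ _ _]negbK -looping_uniq; apply/negP => /card_uniqP.
  rewrite size_traject => too_many; have := max_card (mem (traject f s #|Q|.+1)).
  by rewrite too_many ltnn.
case/trajectP => i i_lt loop; exists (#|Q| - i)%N; first by lia.
move=> n n_ge; rewrite (_ : n + (#|Q| - i) = (n - i) + #|Q|)%N; last by lia.
by rewrite iterD loop -iterD subnK//; lia.
Qed.

Section Phase.
Context {I Q : finType} (step : I -> Q -> Q).
Implicit Types (c : I -> nat) (s : Q).

Definition phase c s : Q := foldl (fun s q => iter (c q) (step q) s) s (enum I).

Lemma eq_phase c c' s : c =1 c' -> phase c s = phase c' s.
Proof. by move=> cc'; rewrite /phase; elim: (enum I) s => //= q l IH s; rewrite cc' IH. Qed.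

Lemma phase_periodic j base c s : (#|Q| <= base)%N ->
  exists lam, (0 < lam <= #|Q|)%N /\
  forall a, phase (fun q => base + if q == j then a + lam else c q)%N s =
            phase (fun q => base + if q == j then a else c q)%N s.
Proof.
move=> Q_le; rewrite /phase.
have := enum_uniq I; have : j \in enum I by rewrite mem_enum.
case/splitPr => e1 e2; rewrite cat_uniq /= => /and3P[_ /norP[j_e1 _] /andP[j_e2 _]].
have skip (e : seq I) a x : j \notin e ->
    foldl (fun s q => iter (base + if q == j then a else c q)%N (step q) s) x e =
    foldl (fun s q => iter (base + c q)%N (step q) s) x e.
  elim: e x => //= q e IH x; rewrite inE negb_or => /andP[jq je].
  by rewrite eq_sym (negbTE jq) IH.
set x := foldl (fun s q => iter (base + c q)%N (step q) s) s e1.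
have [lam lam_bd period] := iter_eventually_periodic (step j) x.
exists lam; split=> // a; rewrite !foldl_cat /= !eqxx !skip// -/x addnA period//.
exact: leq_trans Q_le (leq_addr _ _).
Qed.

End Phase.

Section TwoPhaseRounds.
Context {R : realType} {I Q : finType} (step : I -> Q -> Q) (base N T2 : nat).
Hypotheses (Q_le_base : (#|Q| <= base)%N) (T2_gt0 : (0 < T2)%N).

Local Notation shift := (N`!).
Local Notation T1 := ((N`!).*2).
Local Notation counts := {ffun I -> nat}.
Local Notation counts1 := {ffun I -> 'I_T1}.
Local Notation counts2 := {ffun I -> 'I_T2}.

Definition round_counts : finType := (counts1 * counts2)%type.

(* The offset [base] exceeds the number of states, so every counter of the first
   phase is read in the periodic regime. *)
Definition mid_of s (i : counts1) : Q := phase step (fun q => base + i q)%N s.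

Definition round_step s (w : round_counts) : Q :=
  phase step (fun q => w.2 q : nat) (mid_of s w.1).

Definition round_total (w : round_counts) q : nat := (base + w.1 q + w.2 q)%N.

Fixpoint totals t : rounds round_counts t -> I -> nat :=
  if t is t'.+1 then fun p q => (round_total p.1 q + totals p.2 q)%N
  else fun _ _ => 0%N.

Definition counts_on (X : {set I}) (f : I -> nat) : counts :=
  [ffun q => if q \in X then f q else 0%N].

Definition revelation : eqType := (counts * counts * nat)%type.

Variables (j : I) (X : {set I}).

Definition reveal (w : round_counts) : revelation :=
  (counts_on X (fun q => w.1 q), counts_on X (fun q => w.2 q), w.1 j + w.2 j)%N.

Definition known n (f : {ffun I -> 'I_n}) : counts := counts_on X (fun q => f q).

Definition fill n (kf : counts) a (y : {ffun I -> 'I_n}) q : nat :=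
  if q == j then a else if q \in X then kf q else y q.

Definition refill n (f y : {ffun I -> 'I_n}) a := splice X f (set_at y j a).

Definition mid_state s kf a (y : counts1) : Q :=
  phase step (fun q => base + fill kf a y q)%N s.

Definition resumed_law t (p : rounds round_counts t) kf (u : Q) m
    (y : counts2) : Q -> R :=
  final_law round_step reveal p (phase step (fill kf m y) u).

Definition context_law t (p : rounds round_counts t) s (k1 k2 : counts) n : Q -> R :=
  predicted_law round_step reveal p s (k1, k2, n).

Definition context_error t (p : rounds round_counts t) s k1 k2 :=
  mean_error N T2 (mid_state s k1) (resumed_law p k2) (context_law p s k1 k2).

Definition context_return t (p : rounds round_counts t) s k1 k2 :=
  near_return N T2 (mid_state s k1) (resumed_law p k2) (context_law p s k1 k2).

Definition prob_no_return t s : R :=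
  \avg_(p : rounds round_counts t) \avg_(m : counts2) \avg_(i : counts1)
    (~~ context_return p s (known i) (known m))%:R.

Hypothesis j_notin_X : j \notin X.

Lemma known_splice n (f g : {ffun I -> 'I_n}) : known (splice (j |: X) f g) = known f.
Proof. by apply/ffunP => q; rewrite !ffunE !inE; case: ifP => // ->; rewrite orbT. Qed.

Lemma known_refill n (f y : {ffun I -> 'I_n}) a : known (refill f y a) = known f.
Proof. by apply/ffunP => q; rewrite !ffunE; case: ifP => // ->. Qed.

Lemma known_set_at n (f : {ffun I -> 'I_n}) a : known (set_at f j a) = known f.
Proof.
apply/ffunP => q; rewrite !ffunE; case: ifP => // qX.
by rewrite ifN//; apply: contraNneq j_notin_X => <-.
Qed.

Lemma refillE n (f y : {ffun I -> 'I_n}) a q :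
  (refill f y a q : nat) = fill (known f) a y q.
Proof.
rewrite /fill !ffunE; have [->|_] := eqVneq q j; first by rewrite (negbTE j_notin_X).
by case: ifP.
Qed.

Lemma refill_at n (f y : {ffun I -> 'I_n}) a : refill f y a j = a.
Proof. by rewrite !ffunE (negbTE j_notin_X) eqxx. Qed.

Lemma avg_refill n (a0 : 'I_n) (G : {ffun I -> 'I_n} -> R) :
  \avg_f \avg_a \avg_y G (refill f y a) = avg G.
Proof.
rewrite -(avg_splice X G); apply: eq_avg => f.
by rewrite -(avg_set_at j a0 (fun g => G (splice X f g))).
Qed.

Lemma mid_of_refill s i y a : mid_of s (refill i y a) = mid_state s (known i) a y.
Proof. by apply: eq_phase => q; rewrite refillE. Qed.

Lemma round_step_refill s i y1 a m y2 b : round_step s (refill i y1 a, refill m y2 b) =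
  phase step (fill (known m) b y2) (mid_state s (known i) a y1).
Proof. by rewrite /round_step mid_of_refill; apply: eq_phase => q; rewrite refillE. Qed.

Lemma reveal_refill i y1 (a : 'I_T1) m y2 (b : 'I_T2) :
  reveal (refill i y1 a, refill m y2 b) = (known i, known m, (a + b)%N).
Proof.
rewrite /reveal /= !refill_at -[counts_on _ _]/(known _) known_refill.
by rewrite -[X in (_, X, _)]/(known _) known_refill.
Qed.

Let T1_gt0 : (0 < T1)%N. Proof. by rewrite double_gt0 fact_gt0. Qed.
Let a0 : 'I_T1 := Ordinal T1_gt0.
Let b0 : 'I_T2 := Ordinal T2_gt0.
Let i0 : counts1 := [ffun=> a0].
Let m0 : counts2 := [ffun=> b0].

Lemma avg_round_counts (G : round_counts -> R) :
  \avg_i \avg_m \avg_a \avg_y1 \avg_b \avg_y2 G (refill i y1 a, refill m y2 b) = avg G.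
Proof.
rewrite [RHS]avg_pair -[RHS](avg_refill a0); apply: eq_avg => i.
rewrite exchange_avg; apply: eq_avg => a.
rewrite exchange_avg; apply: eq_avg => y1.
exact: avg_refill b0 (fun m => G (refill i y1 a, m)).
Qed.

Lemma avg_context_error t s :
  \avg_(p : rounds round_counts t) \avg_(i : counts1) \avg_(m : counts2)
    context_error p s (known i) (known m) = forgetting_l1 round_step reveal t s.
Proof.
apply: eq_avg => p; rewrite -[RHS]avg_round_counts.
rewrite /context_error /mean_error /prediction_error; do 6 (apply: eq_avg => ?).
by rewrite round_step_refill reveal_refill.
Qed.

Lemma mid_state_periodic s kf y : exists lam, (0 < lam <= #|Q|)%N /\
  forall a, mid_state s kf (a + lam)%N y = mid_state s kf a y.
Proof. exact: (phase_periodic step j (fun q => if q \in X then kf q else y q) s). Qed.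

Section ShiftedTotalOfOneRound.
Context {t : nat} (s : Q) (phi : rounds round_counts t -> Q -> revelation -> R).
Hypothesis phi_le1 : forall p o u, `|phi p o u| <= 1.

Definition shift_effect (p : rounds round_counts t) (w : round_counts) : R :=
  \sum_o final_law round_step reveal p (round_step s w) o *
    (phi p o (reveal w) - phi p o ((reveal w).1, (reveal w).2 + shift)%N).

Lemma shift_effect_le2 p w : shift_effect p w <= 2.
Proof.
have test_le2 o : phi p o (reveal w) - phi p o ((reveal w).1, (reveal w).2 + shift)%N <= 2.
  have := phi_le1 p o (reveal w).
  have := phi_le1 p o ((reveal w).1, (reveal w).2 + shift)%N.
  by rewrite !ler_norml; lra.
apply: le_trans (ler_sum _ (fun o _ => ler_wpM2l (final_law_ge0 _ _ _ _ _) (test_le2 o))) _.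
by rewrite -mulr_suml final_law_sum mul1r.
Qed.

Lemma avg_context_shift_effect_le p i m :
  \avg_a \avg_y1 \avg_b \avg_y2 shift_effect p (refill i y1 a, refill m y2 b)
  <= (8 * #|Q|%:R + 6) * context_error p s (known i) (known m) + 8 * shift%:R / T2%:R
     + 2 * (~~ context_return p s (known i) (known m))%:R.
Proof.
have error_ge0 : 0 <= context_error p s (known i) (known m) by exact: mean_error_ge0.
have [returns|_] := boolP (context_return p s (known i) (known m)); last first.
  apply: (@le_trans _ _ 2).
    apply: (avg_le_cst a0) => a; apply: (avg_le_cst i0) => y1.
    by apply: (avg_le_cst b0) => b; apply: (avg_le_cst m0) => y2; exact: shift_effect_le2.
  rewrite mulr1 lerDr; apply: addr_ge0; last by rewrite divr_ge0 ?mulr_ge0.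
  by apply: mulr_ge0 => //; rewrite addr_ge0 ?mulr_ge0.
rewrite /= mulr0 addr0.
have := shift_unnoticed i0 m0 T2_gt0 (mid_state_periodic s (known i))
  (fun n => predicted_law_le1 _ _ _ _ _) (fun o n => phi_le1 p o (known i, known m, n)) returns.
apply: le_trans; apply: ler_avg => a; apply: ler_avg => y1; apply: ler_avg => b.
apply: ler_avg => y2; apply: ler_sum => o _.
by rewrite round_step_refill reveal_refill.
Qed.

Lemma avg_shift_effect_le :
  \avg_p \avg_w shift_effect p w
  <= (8 * #|Q|%:R + 6) * forgetting_l1 round_step reveal t s
     + 8 * shift%:R / T2%:R + 2 * prob_no_return t s.
Proof.
under eq_avg => p do rewrite -avg_round_counts.
apply: le_trans (ler_avg (fun p => ler_avg (fun i => ler_avg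
  (avg_context_shift_effect_le p i)))) _.
under eq_avg => p do under eq_avg => i do rewrite avgD avgD avgMl avgMl (avg_cst m0).
under eq_avg => p do
  rewrite avgD avgD avgMl avgMl (avg_cst i0) [X in _ + _ + _ * X]exchange_avg.
by rewrite avgD avgD avgMl avgMl (avg_cst (constant_rounds (i0, m0) t)) avg_context_error.
Qed.

End ShiftedTotalOfOneRound.

Section NoReturnDensity.
Context {t : nat} (p : rounds round_counts t) (s : Q) (m : counts2).
Hypothesis N_gt0 : (0 < N)%N.

Local Notation returns i := (context_return p s (known i) (known m)).

Definition visited (i : counts1) (v : Q) (a : nat) : bool :=
  good_visit N T2 (mid_state s (known i)) (resumed_law p (known m))
    (context_law p s (known i) (known m)) v a.

(* Without near returns each state is visited by at most a fraction [2 / N] of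
   the counts at [j], so this density has mean at most 3 given [X]. *)
Definition visit_density (i : counts1) v : R :=
  if ~~ returns i && visited i v (i j) then N%:R else 1.

Lemma visit_density_gt0 i v : 0 < visit_density i v.
Proof. by rewrite /visit_density; case: ifP => _; rewrite ?ltr0n. Qed.

Lemma visit_density_splice i g v :
  visit_density (splice (j |: X) i g) v = visit_density i v.
Proof. by rewrite /visit_density /visited known_splice ffunE !inE eqxx. Qed.

Lemma avg_ln_visit_density_ge :
  \avg_(i : counts1) (~~ returns i)%:R * (3 / 4 * ln N%:R)
  <= \avg_i ln (visit_density i (mid_of s i)).
Proof.
rewrite -(avg_refill a0 (fun i => ln (visit_density i (mid_of s i)))); apply: ler_avg => i.
have ln_ge0 a y1 : 0 <= ln (visit_density (refill i y1 a) (mid_of s (refill i y1 a))).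
  by rewrite ln_ge0// /visit_density; case: ifP; rewrite ?ler1n.
have [ret|no_ret] := boolP (returns i); first by rewrite mul0r; do 2 (apply: avg_ge0 => ?).
rewrite mul1r; have lnN_ge0 : 0 <= ln N%:R :> R by rewrite exp.ln_ge0// ler1n.
apply: le_trans (ler_wpM2r lnN_ge0 (avg_well_predicted_ge i0 N T2 (mid_state s (known i))
  (resumed_law p (known m)) (context_law p s (known i) (known m)))) _.
rewrite -avgMr; apply: ler_avg => a; rewrite -avgMr; apply: ler_avg => y1.
case: (boolP (well_predicted _ _ _ _ _ _ _)) => [well|_]; last by rewrite mul0r.
rewrite mul1r /visit_density /visited known_refill no_ret refill_at mid_of_refill ifT//.
by apply/existsP; exists y1; rewrite eqxx.
Qed.

Lemma avg_visit_density_le :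
  \avg_i \avg_g visit_density i (mid_of s (splice X i g))
  <= 1 + \avg_(i : counts1) (~~ returns i)%:R * 2.
Proof.
rewrite -(avg_set_at j a0) exchange_avg -[X in X + _](avg_cst i0) -avgD.
apply: ler_avg => i; rewrite exchange_avg; apply: (avg_le_cst i0) => g.
set v := mid_of s (splice X i g).
have densityE a : visit_density (set_at i j a) (mid_of s (splice X (set_at i j a) g)) =
    if ~~ returns i && visited i v a then N%:R else 1.
  rewrite (splice_set_at _ _ _ j_notin_X) -/v /visit_density /visited.
  by rewrite known_set_at ffunE eqxx.
under eq_avg => a do rewrite densityE.
have [ret|no_ret] := boolP (returns i).
  by rewrite mul0r addr0; apply: (avg_le_cst a0).
rewrite mul1r /=; have := good_visits_sparse v no_ret.
rewrite -avgMl -(lerD2l 1) -[X in X + _ <= _](avg_cst a0) -avgD; apply: le_trans.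
apply: ler_avg => a; rewrite /visited; case: ifP => _; first by rewrite mulr1 lerDr.
by rewrite mulr0 addr0.
Qed.

Lemma avg_no_return_le :
  (\avg_(i : counts1) (~~ returns i)%:R) * (3 / 4 * ln N%:R - 2) <=
  cond_entropy (mid_of s) X - cond_entropy (mid_of s) (j |: X) :> R.
Proof.
have := cond_entropy_drop (mid_of s) i0 (finset.subsetUr [set j] X)
  visit_density_gt0 visit_density_splice.
have := avg_ln_visit_density_ge; have := avg_visit_density_le.
by rewrite !avgMr mulrBr; lra.
Qed.

End NoReturnDensity.

Lemma prob_no_return_le t s : (0 < N)%N ->
  prob_no_return t s * (3 / 4 * ln N%:R - 2) <=
  cond_entropy (mid_of s) X - cond_entropy (mid_of s) (j |: X) :> R.
Proof.
move=> N_gt0; rewrite -avgMr; apply: (avg_le_cst (constant_rounds (i0, m0) t)) => p.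
rewrite -avgMr; apply: (avg_le_cst m0) => m.
exact: avg_no_return_le.
Qed.

Definition shift_bound t s : R :=
  (8 * #|Q|%:R + 6) * forgetting_l1 round_step reveal t s + 8 * shift%:R / T2%:R
  + 2 * prob_no_return t s.

Definition staged r t : finType :=
  (rounds round_counts r * round_counts * rounds round_counts t)%type.

Definition staged_total r t (o : staged r t) q : nat :=
  (totals o.1.1 q + (round_total o.1.2 q + totals o.2 q))%N.

Definition staged_run r t s (o : staged r t) : Q :=
  run round_step (round_step (run round_step s o.1.1) o.1.2) o.2.

Definition revealed_total (u : revelation) q : nat :=
  (base + if q == j then u.2 else u.1.1 q + u.1.2 q)%N.

Lemma revealed_totalE w q : q \in j |: X -> round_total w q = revealed_total (reveal w) q.
Proof.
rewrite !inE /revealed_total /round_total /= -addnA; case: eqP => [->//|_ /= qX].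
by rewrite !ffunE qX.
Qed.

Lemma totals_revealedE t (p : rounds round_counts t) q : q \in j |: X ->
  totals p q = (\sum_(u <- revealed reveal p) revealed_total u q)%N.
Proof.
move=> qX; elim: t p => [|t IH] p /=; first by rewrite big_nil.
by rewrite big_cons IH revealed_totalE.
Qed.

Lemma staged_shift_unnoticed r t s (phi : Q -> counts -> R) :
  (forall o g, `|phi o g| <= 1) ->
  \avg_(o : staged r t) (phi (staged_run s o) (counts_on (j |: X) (staged_total o))
    - phi (staged_run s o)
        (counts_on (j |: X) (fun q => staged_total o q + shift * (q == j))%N))
  <= run_avg round_step r (shift_bound t) s.
Proof.
move=> phi_le1; rewrite avg_pair avg_pair; apply: ler_avg => pre.
set s' := run round_step s pre.
pose view (u : revelation) l : counts := counts_on (j |: X) (fun q =>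
  totals pre q + (revealed_total u q + \sum_(v <- l) revealed_total v q))%N.
have viewE w (post : rounds round_counts t) :
    counts_on (j |: X) (staged_total (pre, w, post)) = view (reveal w) (revealed reveal post).
  apply/ffunP => q; rewrite !ffunE; case: ifP => // qX.
  by rewrite /staged_total /= revealed_totalE// (totals_revealedE post qX).
have shifted_viewE w (post : rounds round_counts t) :
    counts_on (j |: X) (fun q => staged_total (pre, w, post) q + shift * (q == j))%N =
    view ((reveal w).1, (reveal w).2 + shift)%N (revealed reveal post).
  apply/ffunP => q; rewrite !ffunE; case: ifP => // qX.
  rewrite /staged_total /= revealed_totalE// (totals_revealedE post qX) /revealed_total /=.
  by case: eqP => _; lia.
pose psi (post : rounds round_counts t) o u := phi o (view u (revealed reveal post)).
have := avg_shift_effect_le s' (phi := psi) (fun _ _ _ => phi_le1 _ _).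
apply: le_trans; rewrite [leRHS]exchange_avg; apply: ler_avg => w.
under eq_avg => post do rewrite viewE shifted_viewE.
by rewrite (avg_run _ reveal _ (round_step s' w) (fun l o => phi o (view (reveal w) l)
  - phi o (view ((reveal w).1, (reveal w).2 + shift)%N l))).
Qed.

End TwoPhaseRounds.
Arguments round_counts : clear implicits.
Arguments staged : clear implicits.
Arguments mid_of {I Q} step base N s i.
Arguments round_step {I Q} step base N T2 s w.
Arguments reveal {I N T2} j X w.

Section ShiftBound.
Context {R : realType} {I Q : finType} (step : I -> Q -> Q) (base N a M : nat).
Variables (j : I) (X : {set I}).
Hypotheses (Q_le : (#|Q| <= M)%N) (M_gt0 : (0 < M)%N) (a_gt0 : (0 < a)%N).
Hypotheses (N_gt0 : (0 < N)%N) (j_notin_X : j \notin X).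

Let T2_gt0 : (0 < a * N`!)%N. Proof. by rewrite muln_gt0 a_gt0 fact_gt0. Qed.
Let T1_gt0 : (0 < (N`!).*2)%N. Proof. by rewrite double_gt0 fact_gt0. Qed.

Definition round_counts0 : round_counts I N (a * N`!) :=
  ([ffun=> Ordinal T1_gt0], [ffun=> Ordinal T2_gt0]).

Local Notation round := (round_step step base N (a * N`!)).
Local Notation forget := (forgetting round (reveal j X)).

Lemma forgetting_l1_bound t s :
  (8 * #|Q|%:R + 6) * forgetting_l1 round (reveal j X) t s
  <= 7 * (a%:R^-1 + a%:R * M%:R ^+ 3 * forget t s) :> R.
Proof.
have aR : 0 < a%:R :> R by rewrite ltr0n.
have MR : 0 < M%:R :> R by rewrite ltr0n.
pose c : R := (a%:R * M%:R ^+ 2)^-1.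
have c_gt0 : 0 < c by rewrite invr_gt0 mulr_gt0// exprn_gt0.
have QM : #|Q|%:R <= M%:R :> R by rewrite ler_nat.
have l1_le : forgetting_l1 round (reveal j X) t s <= (M%:R * c + forget t s / c) / 2.
  apply: le_trans (forgetting_l1_le _ _ round_counts0 t s c_gt0) _.
  by rewrite ler_pM2r// lerD2r ler_pM2r.
have -> : 7 * (a%:R^-1 + a%:R * M%:R ^+ 3 * forget t s) =
    14 * M%:R * ((M%:R * c + forget t s / c) / 2) :> R.
  by rewrite /c; field; rewrite !gt_eqF.
apply: ler_pM => //; first by do 2 (apply: avg_ge0 => ?); exact: l1_dist_ge0.
by have : 1 <= M%:R :> R by [rewrite ler1n]; lra.
Qed.

Lemma shift_bound_le t s : 0 < 3 / 4 * ln N%:R - 2 :> R ->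
  shift_bound step base N (a * N`!) j X t s / 2 <=
  15 / 2 / a%:R + 7 / 2 * a%:R * M%:R ^+ 3 * forget t s
  + (cond_entropy (mid_of step base N s) X - cond_entropy (mid_of step base N s) (j |: X))
      / (3 / 4 * ln N%:R - 2) :> R.
Proof.
move=> gain_gt0; have := forgetting_l1_bound t s.
have := prob_no_return_le (R := R) step base T2_gt0 j_notin_X t s N_gt0.
rewrite -ler_pdivlMr// /shift_bound.
have -> : 8 * (N`!)%:R / (a * N`!)%:R = 8 / a%:R :> R.
  by rewrite natrM; field; rewrite !gt_eqF// ltr0n ?fact_gt0.
by lra.
Qed.

End ShiftBound.

(** * Streams on the grid *)

Notation grid L k := ('I_L * 'I_k)%type.

(* A grid point at level [l] owns a block of [2 ^ l] coordinates. *)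
Notation coords L k := {q : grid L k & 'I_(2 ^ q.1)}.

Section Grid.
Context {L k : nat}.

Definition weight (c : grid L k -> nat) : nat := (\sum_q c q * 2 ^ q.1)%N.

Lemma weightD (c c' : grid L k -> nat) :
  weight (fun q => c q + c' q)%N = (weight c + weight c')%N.
Proof. by rewrite /weight -big_split; apply: eq_bigr => q _; rewrite mulnDl. Qed.

Lemma weight_indic (D : pred (grid L k)) :
  weight D = #|[set p : coords L k | D (tag p)]%SET|.
Proof.
transitivity (\sum_(q : grid L k | D q) \sum_(t < 2 ^ q.1) 1)%N; last first.
  by rewrite sig_big_dep -sum1_card; apply: eq_bigl => p; rewrite inE andbT.
rewrite [RHS]big_mkcond; apply: eq_bigr => q _; rewrite sum1_card card_ord.
by case: (D q); rewrite ?mul1n.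
Qed.

Lemma card_coords : #|{: coords L k}| = weight (fun=> 1%N).
Proof. by rewrite (weight_indic xpredT); apply: eq_card => p; rewrite inE. Qed.

Lemma sum_levels_below m : (m <= L)%N ->
  (\sum_(q : grid L k | q.1 < m) 2 ^ q.1 + k = k * 2 ^ m)%N.
Proof.
move=> mL.
have -> : (\sum_(q : grid L k | q.1 < m) 2 ^ q.1 =
    \sum_(l < L | l < m) \sum_(p < k) 2 ^ l)%N.
  by rewrite pair_big; apply: eq_bigl => q; rewrite andbT.
under eq_bigr => l _ do rewrite sum_nat_const card_ord.
rewrite -big_distrr /= -(big_ord_widen L (fun i => 2 ^ i)%N mL).
have := predn_exp 2 m; rewrite mul1n => <-.
by rewrite -mulnSr prednK ?expn_gt0.
Qed.

Definition level_set (l : 'I_L) : {set grid L k} := [set q : grid L k | q.1 == l]%SET.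

Lemma card_level_set l : #|level_set l| = k.
Proof.
have -> : level_set l = finset.setX [set l]%SET [set: 'I_k]%SET.
  by apply/setP => -[l' p]; rewrite !inE andbT.
by rewrite cardsX cards1 cardsT card_ord mul1n.
Qed.

End Grid.

Lemma exists_coords_embedding (n L k : nat) : (k * 2 ^ L <= n)%N ->
  exists emb : coords L k -> 'I_n, injective emb.
Proof.
move=> kn; have card_le : (#|{: coords L k}| <= n)%N.
  apply: leq_trans kn; rewrite card_coords -(sum_levels_below (leqnn L)).
  rewrite [X in (_ <= X + _)%N](eq_bigl xpredT) => [|q]; last by rewrite ltn_ord.
  by rewrite /weight; under eq_bigr do rewrite mul1n; exact: leq_addr.
exists (fun x => widen_ord card_le (enum_rank x)) => x y /(congr1 val) /= /val_inj.
exact: enum_rank_inj.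
Qed.

Section Streams.
Context {n : nat}.
Implicit Types s : stream n.

Lemma frequency_cat s1 s2 :
  frequency_vector (s1 ++ s2) = frequency_vector s1 + frequency_vector s2.
Proof. exact: big_cat. Qed.

Lemma frequency_flatten (ss : seq (stream n)) :
  frequency_vector (flatten ss) = \sum_(s <- ss) frequency_vector s.
Proof.
elim: ss => [|s ss IH] /=; first by rewrite big_nil /frequency_vector big_nil.
by rewrite frequency_cat big_cons IH.
Qed.

Lemma unit_cat s1 s2 : unit_update_stream s1 -> unit_update_stream s2 ->
  unit_update_stream (s1 ++ s2).
Proof. by rewrite /unit_update_stream all_cat => -> ->. Qed.

End Streams.

Section Words.
Context {n L k : nat}.
Variable emb : coords L k -> 'I_n.
Hypothesis emb_inj : injective emb.
Implicit Types (z : int) (c : grid L k -> nat) (v : grid L k -> int).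

Definition block z (q : grid L k) : stream n :=
  [seq (emb (existT _ q t), z) | t <- enum 'I_(2 ^ q.1)].

Definition word z c : stream n :=
  flatten [seq flatten (nseq (c q) (block z q)) | q <- enum {: grid L k}].

Definition blockwise v : 'rV[int]_n :=
  \sum_(q : grid L k) \sum_(t < 2 ^ q.1) v q *: delta_mx 0 (emb (existT _ q t)).

Lemma size_word z c : size (word z c) = weight c.
Proof.
rewrite /weight -big_enum /word /=; elim: (enum _) => [|q l IH] /=.
  by rewrite big_nil.
rewrite big_cons size_cat IH size_flatten /shape map_nseq sumn_nseq size_map size_enum_ord.
by rewrite mulnC.
Qed.

Lemma unit_word z c : (z == 1) || (z == -1) -> unit_update_stream (word z c).
Proof.
move=> z_unit; apply/allP => u /flattenP[l /mapP[q _ ->]].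
by move=> /flattenP[l' /nseqP[-> _] /mapP[t _ ->]].
Qed.

Lemma weight_le c m : (forall q, c q <= m)%N -> (weight c <= m * n)%N.
Proof.
move=> c_le; apply: (@leq_trans (m * weight (fun _ : grid L k => 1%N))%N); last first.
  by rewrite leq_mul2l -card_coords -[n in leqRHS]card_ord (leq_card emb)// orbT.
by rewrite big_distrr; apply: leq_sum => q _; rewrite mul1n leq_mul2r c_le orbT.
Qed.

Lemma frequency_word z c : frequency_vector (word z c) = blockwise (fun q => z *+ c q).
Proof.
rewrite /word frequency_flatten big_map big_enum; apply: eq_bigr => q _.
rewrite frequency_flatten big_nseq iter_addr_0 /frequency_vector big_map big_enum.
by rewrite -sumrMnl; apply: eq_bigr => t _; rewrite scalerMnl.
Qed.

Lemma eq_blockwise v v' : v =1 v' -> blockwise v = blockwise v'.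
Proof. by move=> vv'; apply: eq_bigr => q _; rewrite vv'. Qed.

Lemma blockwise0 : blockwise (fun=> 0) = 0.
Proof. by apply: big1 => q _; apply: big1 => t _; rewrite scale0r. Qed.

Lemma blockwiseD v v' : blockwise v + blockwise v' = blockwise (fun q => v q + v' q).
Proof.
rewrite -big_split; apply: eq_bigr => q _ /=.
by rewrite -big_split; apply: eq_bigr => t _ /=; rewrite scalerDl.
Qed.

Lemma blockwiseE v i :
  blockwise v ord0 i = \sum_(p : coords L k) v (tag p) * (i == emb p)%:R.
Proof.
transitivity (\sum_(q : grid L k) \sum_(t < 2 ^ q.1) v q * (i == emb (existT _ q t))%:R).
  rewrite summxE; apply: eq_bigr => q _; rewrite summxE; apply: eq_bigr => t _.
  by rewrite !mxE.
by rewrite sig_big_dep; apply: eq_bigr => -[q t].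
Qed.

Lemma blockwise_emb v p : blockwise v ord0 (emb p) = v (tag p).
Proof.
rewrite blockwiseE (bigD1 p)//= eqxx mulr1 big1 ?addr0// => p' p'p.
by rewrite (inj_eq emb_inj) eq_sym (negbTE p'p) mulr0.
Qed.

Lemma L0norm_blockwise v : L0norm (blockwise v) = weight (fun q => v q != 0).
Proof.
rewrite (weight_indic (fun q => v q != 0)) -(card_imset _ emb_inj) /L0norm.
congr #|pred_of_set _|; apply/setP => i; rewrite inE; apply/idP/imsetP => [|[p]]; last first.
  by rewrite inE => vp ->; rewrite blockwise_emb.
case: (pickP (fun p => i == emb p)) => [p /eqP-> vp|out].
  by exists p => //; rewrite inE -blockwise_emb.
by rewrite blockwiseE big1 ?eqxx// => p _; rewrite out mulr0.
Qed.

Lemma foldl_word (Q : finType) (f : Q -> update n -> Q) z c s :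
  foldl f s (word z c) = phase (fun q s => foldl f s (block z q)) c s.
Proof.
rewrite /word /phase; elim: (enum _) s => //= q l IH s.
rewrite foldl_cat IH; congr foldl.
by elim: (c q) s => //= m IHm s; rewrite foldl_cat IHm -iterSr iterS.
Qed.

End Words.

Notation bits L k := {ffun grid L k -> bool}.

(* Alice's stream encodes her bits, Bob subtracts [bob_count], which depends on
   his bits and on a hint. All positions above [level] cancel and all others
   below [level] or off [target] survive, so the norm measures how many bits of
   Alice and Bob agree on [target]. *)
Record protocol (n L k : nat) (emb : coords L k -> 'I_n) := Protocol {
  source : finType;
  source0 : source;
  hint : eqType;
  alice_stream : source -> bits L k -> stream n;
  alice_count : source -> bits L k -> grid L k -> nat;
  alice_hint : source -> bits L k -> hint;
  bob_count : hint -> bits L k -> grid L k -> nat;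
  level : 'I_L;
  target : {set grid L k};
  target_level : forall q, q \in target -> q.1 = level;
  target_large : (k <= 2 * #|target|)%N;
  frequency_alice : forall w b, frequency_vector (alice_stream w b) =
    blockwise emb (fun q => (alice_count w b q)%:R);
  count_above : forall w b (y : bits L k) (q : grid L k), (level < q.1)%N ->
    alice_count w b q = bob_count (alice_hint w b) y q;
  count_elsewhere : forall w b (y : bits L k) (q : grid L k),
    (q.1 <= level)%N -> q \notin target ->
    alice_count w b q != bob_count (alice_hint w b) y q;
  count_target : forall w b (y : bits L k) (q : grid L k), q \in target ->
    (alice_count w b q == bob_count (alice_hint w b) y q) = (b q == y q) }.

Definition protocol_stream n L k (emb : coords L k -> 'I_n) (pi : protocol emb)
    (w : source pi) b y : stream n :=
  alice_stream w b ++ word emb (-1) (bob_count (alice_hint w b) y).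

Definition protocol_within n L k (emb : coords L k -> 'I_n) (pi : protocol emb) W :=
  forall (w : source pi) b y,
    unit_update_stream (protocol_stream w b y) /\ (size (protocol_stream w b y) <= W)%N.

Section ProtocolNorm.
Context {R : realType} {n L k : nat} {emb : coords L k -> 'I_n}.
Hypothesis emb_inj : injective emb.
Variable pi : protocol emb.
Local Notation J := (target pi).
Implicit Types (w : source pi) (b y : bits L k) (q : grid L k).

Definition counts_differ w b y q : bool :=
  alice_count w b q != bob_count (alice_hint w b) y q.

Lemma sum_counts_differ_level w b y :
  (\sum_(q : grid L k | q.1 == level pi) counts_differ w b y q + #|J|
    = k + \sum_(q in J) (b q != y q))%N.
Proof.
have J_level : J \subset level_set (level pi).
  by apply/fintype.subsetP => q /target_level ql; rewrite inE ql.
rewrite (eq_bigl (fun q => q \in level_set (level pi))); last by move=> q; rewrite inE.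
rewrite (big_setID J) /= (finset.setIidPr J_level).
rewrite (eq_bigr (fun q => (b q != y q) : nat)); last first.
  by move=> q qJ; rewrite /counts_differ count_target.
rewrite [X in (_ + X + _)%N](eq_bigr (fun=> 1%N)); last first.
  move=> q; rewrite !inE => /andP[qJ /eqP ql].
  by rewrite /counts_differ count_elsewhere// ql.
have := subset_leq_card J_level.
rewrite sum1_card cardsD (finset.setIidPr J_level) card_level_set => J_le.
by rewrite -addnA subnK// addnC.
Qed.

Lemma weight_counts_differ w b y : weight (counts_differ w b y) =
  (\sum_(q : grid L k | q.1 < level pi) 2 ^ q.1 +
   (\sum_(q : grid L k | q.1 == level pi) counts_differ w b y q) * 2 ^ level pi)%N.
Proof.
rewrite /weight (bigID (fun q : grid L k => (q.1 < level pi)%N)) /=; congr addn.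
  apply: eq_bigr => q lt.
  have qJ : q \notin J by apply/negP => /target_level ql; rewrite ql ltnn in lt.
  by rewrite /counts_differ (count_elsewhere _ _ _ (ltnW lt))// mul1n.
rewrite big_distrl /= [RHS]big_mkcond [LHS]big_mkcond; apply: eq_bigr => q _.
case: ltngtP => [lt|gt|ql] /=; last by rewrite (val_inj ql) eqxx.
- by case: eqP lt => // ->; rewrite ltnn.
- by rewrite /counts_differ (count_above w b y gt) eqxx mul0n; case: eqP.
Qed.

Definition midpoint : R :=
  (2 ^ level pi)%:R * (2 * k%:R - #|J|%:R / 2) - k%:R.

Lemma L0norm_protocol w b y :
  (L0norm (frequency_vector (protocol_stream w b y)))%:R =
  midpoint - (2 ^ level pi)%:R * correlation J b y / 2.
Proof.
rewrite /protocol_stream frequency_cat frequency_alice frequency_word blockwiseD.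
rewrite L0norm_blockwise//.
rewrite (_ : weight _ = weight (counts_differ w b y)); last first.
  by apply: eq_bigr => q _; rewrite mulNrn subr_eq0 eqr_nat.
rewrite weight_counts_differ correlation_hamming /midpoint natrD natrM.
have := sum_counts_differ_level w b y; set differ := (X in (X + #|J|)%N).
have := sum_levels_below (k := k) (ltnW (ltn_ord (level pi))).
set lower := (X in (X + k)%N).
set hamming := (X in (k + X)%N).
move=> /(congr1 (fun x => x%:R : R)) + /(congr1 (fun x => x%:R : R)).
rewrite !natrD natrM => below at_level.
have -> : differ%:R = k%:R + hamming%:R - #|J|%:R :> R by rewrite -at_level; ring.
have -> : lower%:R = k%:R * (2 ^ level pi)%:R - k%:R :> R by rewrite -below; ring.
by field.
Qed.

Variable eps : R.
Hypothesis eps_ge0 : 0 <= eps.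

Lemma L0norm_protocol_error_le w b y :
  eps * (L0norm (frequency_vector (protocol_stream w b y)))%:R
  <= (2 ^ level pi)%:R * (2 * (eps * k%:R)).
Proof.
have -> : (2 ^ level pi)%:R * (2 * (eps * k%:R)) =
    eps * ((2 ^ level pi)%:R * (2 * k%:R)) :> R by ring.
rewrite ler_wpM2l// L0norm_protocol /midpoint.
have := norm_correlation_le (R := R) J b y; rewrite ler_norml => /andP[corr_ge _].
have : 0 <= (2 ^ level pi)%:R * (#|J|%:R + correlation J b y) :> R.
  by rewrite mulr_ge0//; lra.
by have : 0 <= k%:R :> R by []; lra.
Qed.

Lemma approximates_midpoint w b y z :
  approximates eps (frequency_vector (protocol_stream w b y)) z ->
  4 * eps * k%:R < `|correlation J b y| ->
  (z <= midpoint) = (0 <= correlation J b y :> R).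
Proof.
move=> [lo hi] far; have err := L0norm_protocol_error_le w b y.
move: lo hi err; rewrite L0norm_protocol.
set P := (2 ^ level pi)%:R; set Z := correlation J b y in far *.
have P_gt0 : 0 < P :> R by rewrite ltr0n expn_gt0.
move=> lo hi err; have [Z_ge0|Z_lt0] := leP 0 Z.
  rewrite ger0_norm// in far.
  have : P * (4 * eps * k%:R) < P * Z by rewrite ltr_pM2l.
  by move=> ?; apply/idP; lra.
rewrite ltr0_norm// in far.
have : P * (4 * eps * k%:R) < P * - Z by rewrite ltr_pM2l.
by move=> ?; apply/negbTE; rewrite -ltNge; lra.
Qed.

End ProtocolNorm.

(** * Leakage of a correct algorithm *)

Section Leakage.
Context {R : realType} {n L k : nat} {emb : coords L k -> 'I_n}.
Hypothesis emb_inj : injective emb.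
Variables (A : det_algorithm R n) (eps : R) (pi : protocol emb).
Local Notation J := (target pi).
Implicit Types (t : source pi * bits L k) (y : bits L k).

Definition message t : memory A * hint pi :=
  (foldl (@process R n A) (initial A) (alice_stream t.1 t.2), alice_hint t.1 t.2).

Definition leakage : R :=
  (\sum_(j in J) \avg_t bias message snd j (message t) ^+ 2) / #|J|%:R.

Definition avg_abs_correlation : R := \avg_b \avg_y `|correlation J b y|.

Definition success t y : bool :=
  `[< approximates eps (frequency_vector (protocol_stream t.1 t.2 y))
        (output A (protocol_stream t.1 t.2 y)) >].

Definition success_rate : R :=
  (\avg_t \avg_y `|correlation J t.2 y| * (success t y)%:R) / avg_abs_correlation.

Definition decision (u : memory A * hint pi) y : R :=
  if answer (foldl (@process R n A) u.1 (word emb (-1) (bob_count u.2 y))) <= midpoint pi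
  then 1 else -1.

Let y0 : bits L k := [ffun=> true].
Let t0 := (source0 pi, y0).

Hypothesis k_gt0 : (0 < k)%N.

Let card_target_gt0 : 0 < #|J|%:R :> R.
Proof. by rewrite ltr0n; have := target_large pi; lia. Qed.

Lemma avg_abs_correlation_gt0 : 0 < avg_abs_correlation.
Proof.
by apply: lt_le_trans (avg_norm_correlation_ge J); rewrite divr_gt0// sqrtr_gt0.
Qed.

Lemma success_rate_le1 : success_rate <= 1.
Proof.
rewrite ler_pdivrMr ?avg_abs_correlation_gt0// mul1r avg_pair.
apply: (avg_le_cst (source0 pi)) => w; apply: ler_avg => b; apply: ler_avg => y.
by rewrite ler_piMr// lern1 leq_b1.
Qed.

Hypotheses (eps_ge0 : 0 <= eps) (eps_small : (500 * eps) ^+ 2 * k%:R <= 1).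

Lemma norm_decision_le1 u y : `|decision u y| <= 1.
Proof. by rewrite /decision; case: ifP; rewrite ?normrN normr1. Qed.

Lemma decision_correct t y :
  2 * (`|correlation J t.2 y| * (success t y)%:R) - `|correlation J t.2 y| - 8 * eps * k%:R
  <= decision (message t) y * correlation J t.2 y.
Proof.
set Z := correlation J t.2 y.
have trivial_bound : - `|Z| <= decision (message t) y * Z.
  rewrite lerNl -mulrN; apply: le_trans (ler_norm _) _.
  by rewrite normrM normrN ler_piMl// norm_decision_le1.
have slack_ge0 : 0 <= eps * k%:R by rewrite mulr_ge0.
case: (boolP (success t y)) => [/asboolP approx|_]; last by rewrite mulr0; lra.
rewrite mulr1; have [near|far] := leP `|Z| (4 * eps * k%:R); first by lra.
suff -> : decision (message t) y * Z = `|Z| by lra.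
have := approximates_midpoint emb_inj eps_ge0 approx far.
rewrite /output foldl_cat /decision => ->.
by case: (leP 0 Z) => [/ger0_norm->|/ltr0_norm->]; rewrite ?mul1r ?mulN1r.
Qed.

Lemma slack_le_avg_abs_correlation : 80 * (eps * k%:R) <= avg_abs_correlation.
Proof.
apply: le_trans (avg_norm_correlation_ge J).
suff : 320 * (eps * k%:R) <= Num.sqrt #|J|%:R :> R by lra.
have slack_ge0 : 0 <= 320 * (eps * k%:R) by rewrite mulr_ge0 ?mulr_ge0 ?ler0n.
rewrite -(@ler_pXn2r _ 2) ?nnegrE ?sqrtr_ge0 ?sqr_sqrtr ?ler0n ?slack_ge0//.
have : k%:R <= 2 * #|J|%:R :> R by rewrite -natrM ler_nat target_large.
have := ler_wpM2r (ler0n R k) eps_small.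
rewrite mul1r -mulrA -expr2 -exprMn -mulrA; set z := 500 * (eps * k%:R).
have -> : (320 * (eps * k%:R)) ^+ 2 = 256 / 625 * z ^+ 2 by rewrite /z; field.
by have := card_target_gt0; lra.
Qed.

Lemma leakage_ge : 3 / 5 <= success_rate -> 1 / 1600 <= leakage.
Proof.
rewrite ler_pdivlMr ?avg_abs_correlation_gt0// => success_ge.
pose sJ : R := Num.sqrt #|J|%:R.
have sJ_gt0 : 0 < sJ / 40 by rewrite divr_gt0// sqrtr_gt0.
have avg_t_corr : \avg_(t : source pi * bits L k) \avg_y `|correlation J t.2 y| =
    avg_abs_correlation.
  by rewrite avg_pair /= (avg_cst (source0 pi)).
have decides : sJ / 40 <= \avg_t \avg_y decision (message t) y * correlation J t.2 y.
  apply: le_trans (ler_avg (fun t => ler_avg (decision_correct t))).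
  under eq_avg => t do rewrite avgB avgB (avg_cst y0) avgMl.
  rewrite avgB avgB (avg_cst t0) avgMl avg_t_corr.
  have := avg_norm_correlation_ge (R := R) J; have := slack_le_avg_abs_correlation.
  by rewrite -/avg_abs_correlation -/sJ; lra.
have := sum_sqr_bias_ge t0 norm_decision_le1 sJ_gt0 decides.
rewrite /leakage ler_pdivlMr// expr_div_n sqr_sqrtr//.
by apply: le_trans; lra.
Qed.

End Leakage.

Section WeightedIndicators.
Context {R : realType} {d : measure_display} {Seed : measurableType d}.
Context (P : probability Seed R) {I : finType} (E : I -> set Seed) (mu : I -> R).
Hypotheses (mE : forall i, measurable (E i)) (mu_ge0 : forall i, 0 <= mu i).

Let weighted_indicE w :
  (\sum_i mu i * \1_(E i) w)%:E = (\sum_i (mu i)%:E * (\1_(E i) w)%:E)%E.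
Proof. by rewrite -sumEFin; apply: eq_bigr => i _; rewrite EFinM. Qed.

Let measurable_term i : measurable_fun setT (fun w => (mu i)%:E * (\1_(E i) w)%:E)%E.
Proof. by apply: measurable_funeM; apply/measurable_EFinP; exact: measurable_indic. Qed.

Lemma measurable_weighted_indic :
  measurable_fun setT (fun w => (\sum_i mu i * \1_(E i) w)%:E).
Proof. by rewrite (funext weighted_indicE); exact: emeasurable_sum. Qed.

Lemma integral_weighted_indic :
  (\int[P]_w (\sum_i mu i * \1_(E i) w)%:E = \sum_i (mu i)%:E * P (E i))%E.
Proof.
under eq_integral do rewrite weighted_indicE.
rewrite ge0_integral_sum//; last by move=> i w _; rewrite mule_ge0// lee_fin// indicE.
apply: eq_bigr => i _; rewrite ge0_integralZl_EFin ?integral_indic ?setIT//.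
by apply/measurable_EFinP; exact: measurable_indic.
Qed.

(* Yao's principle. A weighted sum of indicators takes finitely many values, so
   if it were below [p] everywhere its integral would be below [p] as well. *)
Lemma exists_weighted_indic_ge (p : R) :
  (forall i, (p%:E <= P (E i))%E) -> \sum_i mu i = 1 ->
  exists w, p <= \sum_i mu i * \1_(E i) w.
Proof.
move=> PE mu_sum; apply/not_existsP => no_seed.
pose value (B : {set I}) : R := \sum_(i in B) mu i.
have valueE w : \sum_i mu i * \1_(E i) w = value [set i | w \in E i]%SET.
  rewrite [RHS]big_mkcond; apply: eq_bigr => i _.
  by rewrite indicE inE; case: (w \in E i); rewrite ?mulr1 ?mulr0.
pose c : R := \big[Order.max/p - 1]_(B : {set I} | value B < p) value B.
have c_lt : c < p by apply: bigmax_lt => //; lra.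
have le_c w : \sum_i mu i * \1_(E i) w <= c.
  by rewrite valueE; apply: le_bigmax_cond; rewrite -valueE ltNge; apply/negP/no_seed.
have int_ge : (p%:E <= \int[P]_w (\sum_i mu i * \1_(E i) w)%:E)%E.
  rewrite integral_weighted_indic -[p]mul1r -mu_sum mulr_suml -sumEFin.
  by apply: lee_sum => i _; rewrite EFinM lee_wpmul2l// lee_fin.
have int_le : (\int[P]_w (\sum_i mu i * \1_(E i) w)%:E <= c%:E)%E.
  have <- : (\int[P]_w (cst c%:E) w = c%:E)%E.
    by rewrite integral_cst// [X in (_ * X)%E](@probability_setT _ _ _ P) mule1.
  apply: ge0_le_integral => //.
  - by move=> w _; rewrite lee_fin sumr_ge0// => i _; rewrite mulr_ge0// indicE.
  - exact: measurable_weighted_indic.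
  - by move=> w _; rewrite lee_fin.
by have := le_trans int_ge int_le; rewrite lee_fin leNgt c_lt.
Qed.

End WeightedIndicators.

Section ProtocolFamily.
Context {R : realType} {n L k : nat} {emb : coords L k -> 'I_n}.
Hypothesis emb_inj : injective emb.
Context {d : measure_display} {Seed : measurableType d} (P : probability Seed R).
Variables (A : Seed -> det_algorithm R n) (eps : R) (W : nat).
Hypothesis A_approximates : approximates_L0 P A eps W.
Context {Th : finType} (th0 : Th) (pi : Th -> protocol emb).
Hypothesis pi_within : forall th, protocol_within (pi th) W.
Hypotheses (k_gt0 : (0 < k)%N) (eps_ge0 : 0 <= eps).
Hypothesis eps_small : (500 * eps) ^+ 2 * k%:R <= 1.

Local Notation play th := (source (pi th) * bits L k * bits L k)%type.

(* The hard distribution weighs a play of a protocol by how clearly the bits of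
   the two players are correlated on the target. *)
Definition play_weight (i : {th : Th & play th}) : R :=
  `|correlation (target (pi (tag i))) (tagged i).1.2 (tagged i).2|
    / avg_abs_correlation (pi (tag i)) / #|{: play (tag i)}|%:R / #|Th|%:R.

Definition play_stream (i : {th : Th & play th}) : stream n :=
  protocol_stream (tagged i).1.1 (tagged i).1.2 (tagged i).2.

Lemma play_weight_ge0 i : 0 <= play_weight i.
Proof.
have norm_gt0 := avg_abs_correlation_gt0 (R := R) (pi (tag i)) k_gt0.
by do 2 (apply: divr_ge0 => //); exact: divr_ge0 (normr_ge0 _) (ltW norm_gt0).
Qed.

Lemma sum_play_weight (G : forall th, source (pi th) * bits L k -> bits L k -> R) :
  \sum_i play_weight i * G (tag i) (tagged i).1 (tagged i).2 =
  \avg_th ((\avg_t \avg_y `|correlation (target (pi th)) t.2 y| * G th t y)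
    / avg_abs_correlation (pi th)).
Proof.
transitivity (\sum_th \sum_(p : play th)
   (`|correlation (target (pi th)) p.1.2 p.2| / avg_abs_correlation (pi th)
     / #|{: play th}|%:R / #|Th|%:R) * G th p.1 p.2).
  by rewrite sig_big_dep; apply: eq_bigr => -[th p].
rewrite [RHS]/avg mulr_suml; apply: eq_bigr => th _.
by rewrite pair_avg [X in _ = X / _ / _]/avg !mulr_suml; apply: eq_bigr => p _; ring.
Qed.

Lemma exists_seed_success_rate_ge :
  exists w, 2 / 3 <= \avg_th success_rate (A w) eps (pi th).
Proof.
have weight_sum : \sum_i play_weight i = 1.
  under eq_bigr do rewrite -[play_weight _]mulr1.
  rewrite (sum_play_weight (fun _ _ _ => 1)) -[RHS](avg_cst th0); apply: eq_avg => th.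
  under eq_avg => t do under eq_avg => y do rewrite mulr1.
  rewrite avg_pair /= (avg_cst (source0 (pi th))) divff// gt_eqF//.
  exact: avg_abs_correlation_gt0.
have stream_ok i : unit_update_stream (play_stream i) /\ (size (play_stream i) <= W)%N.
  exact: pi_within.
pose E i := success_event A eps (play_stream i).
have mE i : measurable (E i) by have [u s] := stream_ok i; have [] := A_approximates u s.
have PE i : ((2 / 3 : R)%:E <= P (E i))%E.
  by have [u s] := stream_ok i; have [] := A_approximates u s.
have [w w_ge] := exists_weighted_indic_ge mE play_weight_ge0 PE weight_sum.
exists w; rewrite -(sum_play_weight (fun th t y => (success (A w) eps t y)%:R)).
apply: (le_trans w_ge); apply: ler_sum => i _.
by rewrite indicE; apply: lexx.
Qed.

Lemma exists_seed_leakage_ge : exists w, 1 / 9600 <= \avg_th leakage (A w) (pi th).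
Proof.
have [w w_ge] := exists_seed_success_rate_ge; exists w.
have leaks th : (success_rate (A w) eps (pi th) - 3 / 5) / 640 <= leakage (A w) (pi th).
  have [low|high] := leP (3 / 5) (success_rate (A w) eps (pi th)).
    have := leakage_ge emb_inj k_gt0 eps_ge0 eps_small low.
    by have := success_rate_le1 (A w) eps (pi th) k_gt0; lra.
  apply: (@le_trans _ _ 0); first by lra.
  by rewrite divr_ge0// sumr_ge0// => j _; apply: avg_ge0 => t; exact: sqr_ge0.
by apply: le_trans (ler_avg leaks); rewrite avgMr avgB (avg_cst th0); lra.
Qed.

End ProtocolFamily.

(** * Short streams *)

Section Segments.
Context {L k : nat}.
Implicit Types (s : 'S_k) (l : 'I_L) (p : nat).

Definition segment s l p : {set grid L k} :=
  [set q : grid L k | (l < q.1)%N || (q.1 == l) && ((s^-1)%g q.2 < p)%N].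

Lemma segmentS s l (p : 'I_k) : segment s l p.+1 = (l, s p) |: segment s l p.
Proof.
apply/setP => -[l' q]; rewrite !inE /= xpair_eqE.
have -> : (q == s p) = ((s^-1)%g q == p) by rewrite -(inj_eq (@perm_inj _ s)) permKV.
by rewrite ltnS [((s^-1)%g q <= p)%N]leq_eqVlt -!val_eqE /= andb_orr orbCA.
Qed.

Lemma notin_segment s l (p : 'I_k) : (l, s p) \notin segment s l p.
Proof. by rewrite inE /= ltnn eqxx permK ltnn. Qed.

Lemma segment_tperm s l (p q : 'I_k) :
  (q <= p)%N -> segment (tperm q p * s)%g l p.+1 = segment s l p.+1.
Proof.
move=> qp; apply/setP => x; rewrite !inE; congr (_ || (_ && _)).
rewrite invMg tpermV permM !ltnS.
by case: tpermP => // ->; rewrite ?leqnn ?qp.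
Qed.

Lemma sum_segment_drops_le (R : realFieldType) (h : {set grid L k} -> R) s :
  (forall X, 0 <= h X) ->
  \sum_(l < L) \sum_(p < k) (h (segment s l p) - h (segment s l p.+1)) <= h finset.set0.
Proof.
move=> h_ge0; pose above (m : nat) := h [set q : grid L k | (m <= q.1)%N]%SET.
have level_sum l :
    \sum_(p < k) (h (segment s l p) - h (segment s l p.+1)) = above l.+1 - above l.
  rewrite -(big_mkord xpredT (fun p => h (segment s l p) - h (segment s l p.+1))).
  rewrite (@telescope_sumr_eq _ 0 k (fun p => - h (segment s l p)))// => [|p _]; last first.
    by rewrite opprK addrC.
  rewrite opprK addrC; congr (h _ - h _); apply/setP => q; rewrite !inE.
    by rewrite ltn0 andbF orbF.
  by rewrite ltn_ord andbT orbC eq_sym -leq_eqVlt.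
under eq_bigr => l _ do rewrite level_sum.
rewrite -(big_mkord xpredT (fun m => above m.+1 - above m)) telescope_sumr//.
have -> : above L = h finset.set0.
  by congr h; apply/setP => q; rewrite !inE leqNgt ltn_ord.
by rewrite gerBl h_ge0.
Qed.

Section EntropyDrop.
Context {R : realType} {A Q : finType} (V : {ffun grid L k -> A} -> Q).

Definition entropy_drop s l p : R :=
  cond_entropy V (segment s l p) - cond_entropy V (segment s l p.+1).

Lemma entropy_dropE s l (p : 'I_k) : entropy_drop s l p =
  cond_entropy V (segment s l p) - cond_entropy V ((l, s p) |: segment s l p).
Proof. by rewrite /entropy_drop segmentS. Qed.

Lemma entropy_drop_ge0 s l (p : 'I_k) : 0 <= entropy_drop s l p.
Proof. by rewrite entropy_dropE subr_ge0 cond_entropy_anti// finset.subsetUr. Qed.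

Lemma sum_entropy_drop_le s S : (#|Q| <= 2 ^ S)%N ->
  \sum_(l < L) \sum_(p < k) entropy_drop s l p <= S%:R.
Proof.
move=> Q_le; apply: le_trans (cond_entropy_le_bits V finset.set0 Q_le).
by apply: sum_segment_drops_le => X; exact: cond_entropy_ge0.
Qed.

End EntropyDrop.
End Segments.

Section BitInformation.
Context {R : realType} {I Q : finType} {D : eqType}.
Context (V : {ffun I -> bool} -> Q) (hint_of : {ffun I -> bool} -> D).
Variables (j : I) (X : {set I}).
Hypotheses (j_notin_X : j \notin X)
  (hint_local : forall f g, hint_of (splice X f g) = hint_of f).
Variable phi : Q * D -> R.
Hypothesis phi_le1 : forall u, `|phi u| <= 1.

Let density (f : {ffun I -> bool}) v : R := 1 + (-1) ^+ f j * phi (v, hint_of f) / 4.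

Let sign_phi_le1 (f : {ffun I -> bool}) v : `|(-1) ^+ f j * phi (v, hint_of f)| <= 1.
Proof. by rewrite normrM normr_sign mul1r. Qed.

Lemma avg_bit_density : \avg_f \avg_g density f (V (splice X f g)) = 1.
Proof.
pose f0 : {ffun I -> bool} := [ffun=> true].
rewrite exchange_avg -[RHS](avg_cst f0); apply: eq_avg => g.
rewrite avgD (avg_cst f0) (avg_odd (j := j)) ?addr0// => f.
have -> : hint_of (set_at f j (~~ f j)) = hint_of f.
  by rewrite -(hint_local _ g) splice_set_at// hint_local.
by rewrite splice_set_at// ffunE eqxx signrN !mulNr.
Qed.

Lemma bit_information :
  2 * (\avg_(b : {ffun I -> bool}) (-1) ^+ b j * phi (V b, hint_of b))
    - \avg_b phi (V b, hint_of b) ^+ 2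
  <= 8 * (cond_entropy V X - cond_entropy V (j |: X)).
Proof.
have hint_localU f g : hint_of (splice (j |: X) f g) = hint_of f.
  by rewrite -(hint_local _ f) spliceS ?finset.subsetUr// hint_local.
have density_gt0 f v : 0 < density f v.
  by have := sign_phi_le1 f v; rewrite /density ler_norml; lra.
have density_splice f g v : density (splice (j |: X) f g) v = density f v.
  by rewrite /density hint_localU ffunE !inE eqxx.
have := cond_entropy_drop V [ffun=> true] (finset.subsetUr [set j]%SET X)
  density_gt0 density_splice.
rewrite avg_bit_density => gain.
have ln_density (f : {ffun I -> bool}) :
    (-1) ^+ f j * phi (V f, hint_of f) / 4 - phi (V f, hint_of f) ^+ 2 / 8
    <= ln (density f (V f)).
  have := sign_phi_le1 f (V f); rewrite ler_norml => sign_phi.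
  apply: le_trans (ln1D_ge_quadratic _); last by lra.
  by rewrite expr_div_n exprMn sqrr_sign; lra.
by have := ler_avg ln_density; rewrite avgB !avgMr; lra.
Qed.

End BitInformation.

Section ShortStreams.
Context {R : realType} {n L k : nat} {emb : coords L k -> 'I_n}.
Hypothesis emb_inj : injective emb.

Definition bit_count (b : bits L k) (q : grid L k) : nat := (1 + b q)%N.

Definition upper_bits (l : 'I_L) (b : bits L k) : bits L k :=
  [ffun q : grid L k => (l < q.1)%N && b q].

Definition upper_count (l : 'I_L) (g y : bits L k) (q : grid L k) : nat :=
  if (l < q.1)%N then bit_count g q else if q.1 == l then bit_count y q else 0%N.

Lemma level_set_level (l : 'I_L) (q : grid L k) : q \in level_set l -> q.1 = l.
Proof. by rewrite inE => /eqP. Qed.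

Lemma level_set_large (l : 'I_L) : (k <= 2 * #|level_set (k := k) l|)%N.
Proof. by rewrite card_level_set; lia. Qed.

Lemma frequency_bit_word b : frequency_vector (word emb 1 (bit_count b)) =
  blockwise emb (fun q => (bit_count b q)%:R).
Proof. exact: frequency_word. Qed.

Lemma upper_count_above (l : 'I_L) b (y : bits L k) (q : grid L k) :
  (l < q.1)%N -> bit_count b q = upper_count l (upper_bits l b) y q.
Proof. by move=> lq; rewrite /upper_count /bit_count lq ffunE lq. Qed.

Lemma upper_count_elsewhere (l : 'I_L) b (y : bits L k) (q : grid L k) :
  (q.1 <= l)%N -> q \notin level_set l ->
  bit_count b q != upper_count l (upper_bits l b) y q.
Proof. by move=> ql; rewrite inE /upper_count ltnNge ql => /negbTE->. Qed.

Lemma upper_count_level (l : 'I_L) b (y : bits L k) (q : grid L k) : q \in level_set l ->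
  (bit_count b q == upper_count l (upper_bits l b) y q) = (b q == y q).
Proof.
rewrite inE /upper_count => /eqP->; rewrite ltnn eqxx /bit_count.
by case: (b q); case: (y q).
Qed.

Definition short_protocol l : protocol emb := {|
  source0 := tt;
  target_level := @level_set_level l;
  target_large := level_set_large l;
  frequency_alice := fun _ => frequency_bit_word;
  count_above := fun _ => @upper_count_above l;
  count_elsewhere := fun _ => @upper_count_elsewhere l;
  count_target := fun _ => @upper_count_level l |}.

Lemma short_protocol_within l : protocol_within (short_protocol l) (4 * n).
Proof.
move=> w b y; split; first by apply: unit_cat; apply: unit_word.
rewrite size_cat !size_word (_ : 4 * n = 2 * n + 2 * n)%N; last by lia.
have bit_count_le2 (c : bits L k) q : (bit_count c q <= 2)%N.
  by rewrite /bit_count; case: (c q).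
apply: leq_add; apply: (weight_le emb_inj) => q //=.
by rewrite /upper_count; do 2 case: ifP => // _.
Qed.

Section Leakage.
Variable A : det_algorithm R n.

Definition short_run (b : bits L k) : memory A :=
  foldl (@process R n A) (initial A) (word emb 1 (bit_count b)).

Lemma leakage_short_protocol_le l : leakage A (short_protocol l) <=
  (\sum_(p < k) 8 * entropy_drop short_run 1%g l p) / k%:R.
Proof.
rewrite /leakage card_level_set ler_wpM2r ?invr_ge0//.
have -> : target (short_protocol l) = [set (l, p) | p : 'I_k]%SET.
  apply/setP => -[l' p]; rewrite !inE /=; apply/eqP/imsetP => [->|[p' _ [-> _]]//].
  by exists p; rewrite ?inE.
rewrite big_imset; last by move=> p p' _ _ [].
apply: ler_sum => p _.
pose msg := message A (pi := short_protocol l); pose phi : _ -> R := bias msg snd (l, p).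
rewrite entropy_dropE perm1.
have phi_le1 u : `|phi u| <= 1 by exact: norm_bias_le1.
have local f g : upper_bits l (splice (segment 1%g l p) f g) = upper_bits l f.
  by apply/ffunP => q; rewrite !ffunE; case: (ltnP l q.1) => //= lq; rewrite inE lq.
have notin := notin_segment 1%g l p; rewrite perm1 in notin.
apply: le_trans (bit_information short_run notin local phi_le1).
have self_bias : \avg_(b : bits L k) (-1) ^+ b (l, p) * phi (short_run b, upper_bits l b) =
    \avg_b phi (short_run b, upper_bits l b) ^+ 2.
  have := avg_sign_bias msg snd (l, p) phi; rewrite !avg_pair !avg_unit => ->.
  by apply: eq_avg => b; rewrite expr2.
by rewrite self_bias avg_pair avg_unit /=; lra.
Qed.

End Leakage.

Context {d : measure_display} {Seed : measurableType d} (P : probability Seed R).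
Variables (A : Seed -> det_algorithm R n) (eps : R) (W S : nat).
Hypotheses (A_approximates : approximates_L0 P A eps W) (A_space : uses_space A S).
Hypotheses (L_gt0 : (0 < L)%N) (k_gt0 : (0 < k)%N).
Hypotheses (eps_ge0 : 0 <= eps) (eps_small : (500 * eps) ^+ 2 * k%:R <= 1).

Lemma short_stream_space_bound : (4 * n <= W)%N -> (L * k)%:R <= 1000 * 80 * S%:R :> R.
Proof.
move=> W_large.
have within l : protocol_within (short_protocol l) W.
  move=> w b y; have [stream_unit size_le] := @short_protocol_within l w b y.
  by split=> //; apply: leq_trans size_le W_large.
have [w] := exists_seed_leakage_ge emb_inj A_approximates (Ordinal L_gt0) within
  k_gt0 eps_ge0 eps_small.
move=> /le_trans/(_ (ler_avg (leakage_short_protocol_le (A w)))).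
rewrite avgMr /avg card_ord; under eq_bigr => l _ do rewrite -mulr_sumr.
rewrite -mulr_sumr -mulrA -invfM ler_pdivlMr ?mulr_gt0 ?ltr0n// natrM.
have : 0 <= S%:R :> R by [].
by have := sum_entropy_drop_le (R := R) (@short_run (A w)) 1%g (A_space w); lra.
Qed.

End ShortStreams.

(** * Long streams *)

Section RoundStreams.
Context {n L k : nat} (emb : coords L k -> 'I_n) (base N T2 : nat).
Local Notation counts := (round_counts (grid L k) N T2).
Implicit Types (w : counts) (q : grid L k).

Definition round_word w : stream n :=
  word emb 1 (fun q => base + w.1 q)%N ++ word emb 1 (fun q => w.2 q).

Fixpoint rounds_word t : rounds counts t -> stream n :=
  if t is t'.+1 then fun p => round_word p.1 ++ rounds_word p.2 else fun=> [::].

Definition staged_word r t (o : staged (grid L k) N T2 r t) : stream n :=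
  rounds_word o.1.1 ++ (round_word o.1.2 ++ rounds_word o.2).

Lemma size_round_word w : size (round_word w) = weight (round_total base w).
Proof. by rewrite size_cat !size_word -weightD. Qed.

Lemma size_rounds_word t (p : rounds counts t) :
  size (rounds_word p) = weight (totals base p).
Proof.
elim: t p => [|t IH] p /=; first by rewrite /weight big1// => q _; rewrite mul0n.
by rewrite size_cat size_round_word IH -weightD.
Qed.

Lemma size_staged_word r t (o : staged (grid L k) N T2 r t) :
  size (staged_word o) = weight (staged_total base o).
Proof.
rewrite (size_cat (rounds_word _)) (size_cat (round_word _)).
by rewrite size_round_word !size_rounds_word -!weightD.
Qed.

Lemma blockwise_natD (c c' : grid L k -> nat) :
  blockwise emb (fun q => (c q)%:R) + blockwise emb (fun q => (c' q)%:R) =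
  blockwise emb (fun q => (c q + c' q)%N%:R).
Proof. by rewrite blockwiseD; apply: eq_blockwise => q; rewrite natrD. Qed.

Lemma frequency_round_word w :
  frequency_vector (round_word w) = blockwise emb (fun q => (round_total base w q)%:R).
Proof. by rewrite frequency_cat !frequency_word blockwise_natD. Qed.

Lemma frequency_rounds_word t (p : rounds counts t) :
  frequency_vector (rounds_word p) = blockwise emb (fun q => (totals base p q)%:R).
Proof.
elim: t p => [|t IH] p /=; first by rewrite blockwise0 /frequency_vector big_nil.
by rewrite frequency_cat frequency_round_word IH blockwise_natD.
Qed.

Lemma frequency_staged_word r t (o : staged (grid L k) N T2 r t) :
  frequency_vector (staged_word o) = blockwise emb (fun q => (staged_total base o q)%:R).
Proof.
rewrite (frequency_cat (rounds_word _)) (frequency_cat (round_word _)).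
by rewrite frequency_round_word !frequency_rounds_word !blockwise_natD.
Qed.

Lemma unit_round_word w : unit_update_stream (round_word w).
Proof. by apply: unit_cat; apply: unit_word. Qed.

Lemma unit_rounds_word t (p : rounds counts t) : unit_update_stream (rounds_word p).
Proof. by elim: t p => [|t IH] p //=; apply: unit_cat; [exact: unit_round_word|]. Qed.

Lemma unit_staged_word r t (o : staged (grid L k) N T2 r t) :
  unit_update_stream (staged_word o).
Proof.
apply: unit_cat; first exact: unit_rounds_word.
by apply: unit_cat; [exact: unit_round_word | exact: unit_rounds_word].
Qed.

Definition max_round_total : nat := base + (N`!).*2 + T2.

Lemma totals_le t (p : rounds counts t) q : (totals base p q <= t * max_round_total)%N.
Proof.
elim: t p => [|t IH] p //=; rewrite mulSn leq_add//.
by rewrite /round_total !leq_add// ltnW.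
Qed.

Lemma staged_total_bounds r t (o : staged (grid L k) N T2 r t) q :
  (base <= staged_total base o q <= (r + t.+1) * max_round_total)%N.
Proof.
rewrite /staged_total /round_total; have := totals_le o.1.1 q; have := totals_le o.2 q.
have := ltn_ord (o.1.2.1 q); have := ltn_ord (o.1.2.2 q).
rewrite mulnDl mulSn [in X in (_ <= _ <= _ + (X + _))%N]/max_round_total; lia.
Qed.

Section RunOnRounds.
Context {R : realType} (A : det_algorithm R n).

Definition block_step q (s : memory A) : memory A :=
  foldl (@process R n A) s (block emb 1 q).

Lemma foldl_round_word s w :
  foldl (@process R n A) s (round_word w) = round_step block_step base N T2 s w.
Proof. by rewrite foldl_cat !foldl_word. Qed.

Lemma foldl_rounds_word t s (p : rounds counts t) :
  foldl (@process R n A) s (rounds_word p) = run (round_step block_step base N T2) s p.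
Proof. by elim: t s p => [|t IH] s p //=; rewrite foldl_cat foldl_round_word IH. Qed.

Lemma foldl_staged_word r t s (o : staged (grid L k) N T2 r t) :
  foldl (@process R n A) s (staged_word o) = staged_run block_step base s o.
Proof.
rewrite (foldl_cat _ _ (rounds_word _)) (foldl_cat _ _ (round_word _)).
by rewrite foldl_round_word !foldl_rounds_word.
Qed.

End RunOnRounds.
End RoundStreams.
Arguments block_step {n L k} emb {R} A q s.

(* Alice's stream does not depend on her bits: she hides bit [b q] of a target
   position by adding [N`! * b q] to the count of [q] that she sends in the hint. *)
Section LongProtocol.
Context {n L k : nat} (emb : coords L k -> 'I_n) (base N T2 r t : nat).
Hypotheses (T2_gt0 : (0 < T2)%N) (base_large : (N`! <= base)%N).
Variables (s : 'S_k) (l : 'I_L) (p : 'I_k).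
Hypothesis p_upper : (k <= p.+1.*2)%N.

Local Notation shift := (N`!).
Local Notation staged := (staged (grid L k) N T2 r t).
Implicit Types (o : staged) (b y : bits L k) (q : grid L k).

Definition long_target : {set grid L k} :=
  [set q : grid L k | (q.1 == l) && ((s^-1)%g q.2 <= p)%N]%SET.

Definition target_point (i : 'I_p.+1) : grid L k := (l, s (widen_ord (ltn_ord p) i)).

Definition long_hint o b : {ffun grid L k -> nat} :=
  counts_on (segment s l p.+1)
    (fun q => staged_total base o q + shift * (b q && (q \in long_target)))%N.

Definition long_bob_count (g : {ffun grid L k -> nat}) y q : nat :=
  if q \in long_target then (g q - shift * y q)%N else g q.

Lemma target_point_inj : injective target_point.
Proof. by move=> i i' [/perm_inj/(congr1 val)/= /val_inj]. Qed.

Lemma long_targetE : long_target = [set target_point i | i : 'I_p.+1]%SET.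
Proof.
apply/setP => -[l' q]; rewrite !inE /=; apply/andP/imsetP => [[/eqP-> q_le]|[i _ [-> ->]]].
  exists (Ordinal (q_le : (s^-1)%g q < p.+1)%N) => //; congr (_, _).
  by rewrite -[LHS](permKV s); congr (s _); exact: val_inj.
by rewrite eqxx permK -ltnS /= ltn_ord.
Qed.

Lemma card_long_target : #|long_target| = p.+1.
Proof. by rewrite long_targetE (card_imset _ target_point_inj) card_ord. Qed.

Lemma avg_long_target (R : realFieldType) (F : grid L k -> R) :
  (\sum_(q in long_target) F q) / #|long_target|%:R = \avg_i F (target_point i).
Proof.
rewrite card_long_target /avg card_ord long_targetE big_imset; last first.
  by move=> i i' _ _; exact: target_point_inj.
by under eq_bigl do rewrite inE.
Qed.

Lemma target_point_in i : target_point i \in long_target.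
Proof. by rewrite long_targetE imset_f. Qed.

Lemma long_target_sub q : q \in long_target -> q \in segment s l p.+1.
Proof. by rewrite !inE => /andP[/eqP-> q_le]; rewrite eqxx ltnS q_le orbT. Qed.

Lemma long_target_level q : q \in long_target -> q.1 = l.
Proof. by rewrite inE => /andP[/eqP]. Qed.

Lemma long_target_large : (k <= 2 * #|long_target|)%N.
Proof. by rewrite card_long_target mul2n. Qed.

Lemma long_count_above o b y q : (l < q.1)%N ->
  staged_total base o q = long_bob_count (long_hint o b) y q.
Proof.
move=> lq; have qJ : (q \in long_target) = false by rewrite inE -val_eqE /= gtn_eqF.
by rewrite /long_bob_count !ffunE qJ andbF muln0 addn0 inE lq.
Qed.

Lemma long_count_elsewhere o b y q : (q.1 <= l)%N -> q \notin long_target ->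
  staged_total base o q != long_bob_count (long_hint o b) y q.
Proof.
move=> ql qJ; rewrite /long_bob_count (negbTE qJ) ffunE.
have /negbTE-> : q \notin segment s l p.+1.
  apply: contra qJ; rewrite !inE ltnNge ql /= ltnS => /andP[/eqP ql' ->].
  by rewrite -val_eqE /= ql' eqxx.
rewrite -lt0n; have /andP[base_le _] := staged_total_bounds base o q.
exact: leq_trans (fact_gt0 N) (leq_trans base_large base_le).
Qed.

Lemma long_count_target o b y q : q \in long_target ->
  (staged_total base o q == long_bob_count (long_hint o b) y q) = (b q == y q).
Proof.
move=> qJ; rewrite /long_bob_count qJ ffunE long_target_sub// qJ andbT.
have /andP[base_le _] := staged_total_bounds base o q.
have := leq_trans base_large base_le; have := fact_gt0 N.
by case: (b q); case: (y q); rewrite ?muln1 ?muln0; lia.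
Qed.

Definition constant_staged : staged :=
  let w := ([ffun=> Ordinal (etrans (double_gt0 _) (fact_gt0 N) : 0 < (N`!).*2)%N],
    [ffun=> Ordinal T2_gt0]) in
  (constant_rounds w r, w, constant_rounds w t).

Definition long_protocol : protocol emb := {|
  source0 := constant_staged;
  target_level := long_target_level;
  target_large := long_target_large;
  frequency_alice := fun o _ => frequency_staged_word emb base o;
  count_above := long_count_above;
  count_elsewhere := long_count_elsewhere;
  count_target := long_count_target |}.

Lemma long_protocol_within : injective emb ->
  protocol_within long_protocol ((((r + t.+1) * max_round_total base N T2).*2 + shift) * n).
Proof.
move=> emb_inj o b y; split.
  by apply: unit_cat; [exact: unit_staged_word | exact: unit_word].
rewrite size_cat size_staged_word size_word; set m := ((r + t.+1) * _)%N.
have total_le q : (staged_total base o q <= m)%N.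
  by have /andP[] := staged_total_bounds base o q.
rewrite -addnn -addnA mulnDl; apply: leq_add; apply: (weight_le emb_inj) => q //.
apply: (@leq_trans (long_hint o b q)).
  by rewrite /= /long_bob_count; case: ifP => // _; exact: leq_subr.
rewrite ffunE; case: ifP => // _; rewrite leq_add//.
by case: (_ && _); rewrite ?muln1 ?muln0.
Qed.

End LongProtocol.

Section HiddenBits.
Context {R : realType} {n L k : nat} (emb : coords L k -> 'I_n) (base N T2 r t : nat).
Hypotheses (T2_gt0 : (0 < T2)%N) (base_large : (N`! <= base)%N).
Context (s : 'S_k) (l : 'I_L) (p : 'I_k) (p_upper : (k <= p.+1.*2)%N).
Variable A : det_algorithm R n.
Hypothesis memory_le_base : (#|memory A| <= base)%N.

Local Notation pi := (long_protocol emb r t T2_gt0 base_large s l p_upper).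
Local Notation step := (block_step emb A).

Lemma avg_sign_message_le (j : grid L k) (X : {set grid L k})
    (phi : memory A * {ffun grid L k -> nat} -> R) :
  j \notin X -> j |: X = segment s l p.+1 -> j \in long_target s l p ->
  (forall u, `|phi u| <= 1) ->
  \avg_(i : source pi * bits L k) (-1) ^+ i.2 j * phi (message A i)
  <= run_avg (round_step step base N T2) r (shift_bound step base N T2 j X t)
       (initial A) / 2.
Proof.
move=> jX jXE jJ phi_le1; rewrite avg_pair exchange_avg.
pose F (b : bits L k) := \avg_(o : source pi) (-1) ^+ b j * phi (message A (o, b)).
have -> : avg F = \avg_b (F b + F (set_at b j (~~ b j))) / 2.
  by rewrite avgMr avgD -(avg_flip j F); field.
apply: (avg_le_cst [ffun=> true]) => b; rewrite ler_pM2r//.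
pose H c := \avg_(o : source pi) phi (message A (o, set_at b j c)).
have -> : F b + F (set_at b j (~~ b j)) = H false - H true.
  have F_set_at c : F (set_at b j c) = (-1) ^+ c * H c.
    by rewrite /H -avgMl; apply: eq_avg => o; rewrite ffunE eqxx.
  have -> : F b = (-1) ^+ b j * H (b j) by rewrite -F_set_at set_atxx.
  by rewrite F_set_at; case: (b j); rewrite mulN1r mul1r// addrC.
pose psi v (g : {ffun grid L k -> nat}) : R := phi (v, counts_on (segment s l p.+1)
  (fun q => g q + N`! * (set_at b j false q && (q \in long_target s l p)))%N).
have := staged_shift_unnoticed step N memory_le_base T2_gt0 jX r t (initial A)
  (phi := psi) (fun _ _ => phi_le1 _).
rewrite -/H; congr (_ <= _ : Prop); rewrite /H -avgB; apply: eq_avg => o.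
rewrite /psi /message /= foldl_staged_word jXE.
symmetry; congr (phi (_, _) - phi (_, _)).
  by apply/ffunP => q; rewrite !ffunE; case: ifP.
apply/ffunP => q; rewrite !ffunE; case: ifP => // _.
have [->|_] := eqVneq q j; last by rewrite muln0 addn0.
by rewrite jJ !muln1 muln0 addn0.
Qed.

Lemma leakage_long_protocol_le : leakage A pi <=
  \avg_i run_avg (round_step step base N T2) r (shift_bound step base N T2
    (target_point s l i) (segment (tperm (widen_ord (ltn_ord p) i) p * s)%g l p) t)
    (initial A) / 2.
Proof.
rewrite /leakage avg_long_target; apply: ler_avg => i.
set j := target_point s l i; set s' := (tperm _ p * s)%g.
have jE : j = (l, s' p) by rewrite /j /target_point /s' permM tpermR.
have i_le : (widen_ord (ltn_ord p) i <= p)%N by have := ltn_ord i; rewrite ltnS.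
pose phi : _ -> R := bias (message A (pi := pi)) snd j.
have self_bias : \avg_(x : source pi * bits L k) phi (message A x) ^+ 2 =
    \avg_(x : source pi * bits L k) (-1) ^+ x.2 j * phi (message A x).
  by rewrite avg_sign_bias; apply: eq_avg => x; rewrite expr2.
rewrite self_bias; apply: avg_sign_message_le.
- by rewrite jE notin_segment.
- by rewrite jE -segmentS segment_tperm.
- exact: target_point_in.
- exact: norm_bias_le1.
Qed.

End HiddenBits.

Section LongStreams.
Context {R : realType} {n L k' : nat} (emb : coords L k'.*2 -> 'I_n).
Variables (S N a : nat).
Hypotheses (L_gt0 : (0 < L)%N) (k'_gt0 : (0 < k')%N) (N_gt0 : (0 < N)%N)
  (a_gt0 : (0 < a)%N).

Local Notation k := (k'.*2).
Local Notation M := (2 ^ S)%N.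
Local Notation base := (M + N`!)%N.
Local Notation T2 := (a * N`!)%N.
Local Notation tau := (a ^ 2 * M ^ 3)%N.

Let M_gt0 : (0 < M)%N. Proof. by rewrite expn_gt0. Qed.
Let T2_gt0 : (0 < T2)%N. Proof. by rewrite muln_gt0 a_gt0 fact_gt0. Qed.
Let tau_gt0 : (0 < tau)%N. Proof. by rewrite muln_gt0 !expn_gt0 a_gt0. Qed.

Lemma upper_rank_lt (p : 'I_k') : (k' + p < k)%N.
Proof. by rewrite -addnn ltn_add2l. Qed.

Definition upper_rank (p : 'I_k') : 'I_k := Ordinal (upper_rank_lt p).

Lemma upper_rank_large (p : 'I_k') : (k <= (upper_rank p).+1.*2)%N.
Proof. by rewrite leq_double ltnW// ltnS leq_addr. Qed.

Lemma ler_sum_upper_rank (F : 'I_k -> R) : (forall p, 0 <= F p) ->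
  \sum_(p < k') F (upper_rank p) <= \sum_(p < k) F p.
Proof.
move=> F_ge0; rewrite -(big_imset F (h := upper_rank) (A := 'I_k')) /=; last first.
  by move=> p p' _ _ /(congr1 val) /= /addnI /val_inj.
by rewrite [leRHS](bigID (mem (upper_rank @: 'I_k'))) /= lerDl sumr_ge0.
Qed.

Local Notation upto p := ('I_(upper_rank p).+1).
Local Notation long_index := ('S_k * 'I_tau * ('I_L * 'I_k'))%type.
Implicit Types (s : 'S_k) (r : 'I_tau) (l : 'I_L) (p : 'I_k').

Let later r := (tau.-1 - r)%N.

Definition long_family (i : long_index) : protocol emb :=
  long_protocol emb i.1.2 (later i.1.2) T2_gt0 (leq_addl M N`!) i.1.1 i.2.1
    (upper_rank_large i.2.2).

Lemma long_family_within W i : injective emb ->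
  (((tau * max_round_total base N T2).*2 + N`!) * n <= W)%N ->
  protocol_within (long_family i) W.
Proof.
move=> emb_inj W_large o b y.
have [stream_unit] := long_protocol_within emb_inj (o : source (long_family i)) b y.
have -> : (i.1.2 + (later i.1.2).+1 = tau)%N by rewrite /later; have := ltn_ord i.1.2; lia.
by split=> //; apply: leq_trans W_large.
Qed.

Section OneAlgorithm.
Variable A : det_algorithm R n.
Hypothesis memory_le : (#|memory A| <= M)%N.
Local Notation step := (block_step emb A).
Local Notation round := (round_step step base N T2).
Local Notation start := (initial A).
Local Notation gain := (3 / 4 * ln N%:R - 2 : R).
Hypothesis gain_gt0 : 0 < gain.

Definition moved_last s p (q : upto p) : 'S_k :=
  (tperm (widen_ord (ltn_ord (upper_rank p)) q) (upper_rank p) * s)%g.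

Definition forgetting_after s l p r (q : upto p) : R :=
  run_avg round r (forgetting round
    (reveal (target_point s l q) (segment (moved_last s q) l (upper_rank p)))
    (later r)) start.

Definition drop_after s l r (p : 'I_k) : R :=
  run_avg round r (fun v => entropy_drop (mid_of step base N v) s l p) start.

Lemma leakage_long_family_le s r l p : leakage A (long_family (s, r, (l, p))) <=
  \avg_(q : upto p) (15 / 2 / a%:R + 7 / 2 * a%:R * M%:R ^+ 3 * forgetting_after s l r q
    + drop_after (moved_last s q) l r (upper_rank p) / gain).
Proof.
have memory_le_base := leq_trans memory_le (leq_addr N`! M).
apply: le_trans (leakage_long_protocol_le _ _ _ _ _ _ _ _ memory_le_base) _.
apply: ler_avg => q; apply: run_avg_le_affine => [|v].
  exact: round_counts0 a_gt0.
set j := target_point _ _ _; set X := segment _ _ _.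
have jE : j = (l, moved_last s q (upper_rank p)).
  by rewrite /j /target_point /moved_last permM tpermR.
have jX : j \notin X by rewrite jE notin_segment.
rewrite entropy_dropE -jE.
have := shift_bound_le step base memory_le M_gt0 a_gt0 N_gt0 jX (later r) v gain_gt0.
exact.
Qed.

Lemma avg_forgetting_after_le s l p (q : upto p) :
  \avg_r forgetting_after s l r q <= tau%:R^-1.
Proof.
rewrite /avg card_ord -[leRHS]mul1r ler_wpM2r ?invr_ge0//.
exact: sum_forgetting_le1 (round_counts0 _ a_gt0) _ _.
Qed.

(* The family ranges over [s] so that every target point can play the role of the last. *)
Lemma avg_drop_after_perm l r p :
  \avg_s \avg_(q : upto p) drop_after (moved_last s q) l r (upper_rank p) =
  \avg_s drop_after s l r (upper_rank p).
Proof.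
rewrite exchange_avg -[RHS](avg_cst (ord0 : upto p)); apply: eq_avg => q.
pose u := tperm (widen_ord (ltn_ord (upper_rank p)) q) (upper_rank p).
rewrite [RHS](reindex_avg (h := fun s => u * s)%g)//.
by exists (fun s => u^-1 * s)%g => s; rewrite ?mulKg ?mulKVg.
Qed.

Lemma avg_drop_after_le s r :
  \avg_l \avg_p drop_after s l r (upper_rank p) <= S%:R / (L%:R * k'%:R).
Proof.
under eq_avg => l do rewrite exchange_avg.
rewrite exchange_avg.
apply: (avg_le_cst (constant_rounds (round_counts0 _ a_gt0) r)) => pre.
set v := run _ _ _; under eq_avg => l do rewrite /avg card_ord.
rewrite avgMr /avg card_ord -mulrA -invfM ler_wpM2r ?invr_ge0 ?mulr_ge0//.
apply: le_trans (sum_entropy_drop_le (mid_of step base N v) s memory_le).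
apply: ler_sum => l _; apply: ler_sum_upper_rank => p; exact: entropy_drop_ge0.
Qed.

Lemma avg_leakage_long_family_le :
  \avg_i leakage A (long_family i) <= 11 / a%:R + S%:R / (L%:R * k'%:R) / gain.
Proof.
have aR : 0 < a%:R :> R by rewrite ltr0n.
have MR : 0 < M%:R :> R by rewrite ltr0n.
have level0 : 'I_L * 'I_k' := (Ordinal L_gt0, Ordinal k'_gt0).
pose forgotten (i : long_index) :=
    \avg_(q : upto i.2.2) forgetting_after i.1.1 i.2.1 i.1.2 q.
pose dropped (i : long_index) := \avg_(q : upto i.2.2)
    drop_after (moved_last i.1.1 q) i.2.1 i.1.2 (upper_rank i.2.2).
have leakage_le i : leakage A (long_family i) <=
    15 / 2 / a%:R + 7 / 2 * a%:R * M%:R ^+ 3 * forgotten i + dropped i / gain.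
  case: i => [[s r] [l p]]; apply: le_trans (leakage_long_family_le s r l p) _.
  by rewrite avgD avgD (avg_cst ord0) avgMl [X in _ + X <= _]avgMr.
have forgotten_le : avg forgotten <= tau%:R^-1.
  rewrite avg_pair exchange_avg; apply: (avg_le_cst level0) => -[l p].
  rewrite avg_pair; apply: (avg_le_cst 1%g) => s.
  rewrite /forgotten /= exchange_avg.
  apply: (avg_le_cst ord0) => q; exact: avg_forgetting_after_le.
have dropped_le : avg dropped <= S%:R / (L%:R * k'%:R).
  rewrite avg_pair avg_pair exchange_avg; apply: (avg_le_cst (Ordinal tau_gt0)) => r.
  rewrite /dropped /= exchange_avg; under eq_avg => lp do rewrite avg_drop_after_perm.
  rewrite exchange_avg; apply: (avg_le_cst 1%g) => s.
  by rewrite avg_pair; exact: avg_drop_after_le.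
apply: le_trans (ler_avg leakage_le) _.
rewrite avgD avgD (avg_cst (1%g, Ordinal tau_gt0, level0)) avgMl avgMr.
apply: lerD; last by rewrite ler_pM2r// invr_gt0.
have tau_cost : 7 / 2 * a%:R * M%:R ^+ 3 * tau%:R^-1 = 7 / 2 / a%:R :> R.
  by rewrite natrM (natrX _ a) (natrX _ M 3); field; rewrite !gt_eqF.
have : 7 / 2 * a%:R * M%:R ^+ 3 * avg forgotten <= 7 / 2 / a%:R.
  by rewrite -tau_cost ler_wpM2l// !mulr_ge0 ?exprn_ge0.
by lra.
Qed.

End OneAlgorithm.

Hypothesis emb_inj : injective emb.
Context {d : measure_display} {Seed : measurableType d} (P : probability Seed R).
Variables (A : Seed -> det_algorithm R n) (eps : R) (W : nat).
Hypotheses (A_approximates : approximates_L0 P A eps W) (A_space : uses_space A S).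
Hypotheses (eps_ge0 : 0 <= eps) (eps_small : (500 * eps) ^+ 2 * k%:R <= 1).
Hypotheses (lnN_ge : 8 <= ln N%:R :> R) (a_large : 1000 * 1000 <= a%:R :> R).
Hypothesis W_large : (((tau * max_round_total base N T2).*2 + N`!) * n <= W)%N.

Lemma long_stream_space_bound : (L * k')%:R * ln N%:R <= 1000 * 30 * S%:R :> R.
Proof.
have gain_gt0 : 0 < 3 / 4 * ln N%:R - 2 :> R by move: lnN_ge; lra.
have k_gt0 : (0 < k)%N by rewrite double_gt0.
have within i := @long_family_within W i emb_inj W_large.
pose i0 : long_index := (1%g, Ordinal tau_gt0, (Ordinal L_gt0, Ordinal k'_gt0)).
have [w] := exists_seed_leakage_ge emb_inj A_approximates i0 within k_gt0 eps_ge0 eps_small.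
move=> /le_trans/(_ (avg_leakage_long_family_le (A_space w) gain_gt0)) leak.
have noise : 11 / a%:R <= 11 / 1000 / 1000 :> R.
  by rewrite ler_pdivrMr ?ltr0n//; move: a_large; lra.
have Lk_gt0 : 0 < L%:R * k'%:R :> R by rewrite mulr_gt0 ?ltr0n.
have : 9 / 100 / 1000 <= S%:R / (L%:R * k'%:R) / (3 / 4 * ln N%:R - 2) :> R by lra.
rewrite ler_pdivlMr// ler_pdivlMr// natrM; set Lk := L%:R * k'%:R in Lk_gt0 *.
have : Lk * 8 <= Lk * ln N%:R by rewrite ler_pM2l.
by lra.
Qed.

End LongStreams.

(** * Choice of parameters *)

Lemma fact_leq_expn n : (n`! <= n ^ n)%N.
Proof.
have <- : (\prod_(1 <= i < n.+1) n = n ^ n)%N by rewrite prod_nat_const_nat subn1.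
by rewrite fact_prod !big_nat; apply: leq_prod => i /andP[_]; rewrite ltnS.
Qed.

Lemma ln_fact_le (R : realType) n : ln (n`!)%:R <= n%:R ^+ 2 :> R.
Proof.
have [->|n_gt0] := posnP n; first by rewrite fact0 ln1 sqr_ge0.
have nR : 0 < n%:R :> R by rewrite ltr0n.
apply: (@le_trans _ _ (ln (n%:R ^+ n))).
  by rewrite ler_ln ?posrE ?exprn_gt0 ?ltr0n ?fact_gt0// -natrX ler_nat fact_leq_expn.
rewrite lnXn// -[_ *+ n]mulr_natl expr2 ler_wpM2l// ltW//.
exact: ln_sublinear.
Qed.

Section GridParameters.
Context {R : realType} (n : nat) (eps : R).
Hypotheses (n_gt0 : (0 < n)%N) (eps_ge : n%:R `^ (- (49 / 100)) <= eps).
Hypothesis eps_le : eps <= 1 / 1000.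

Lemma eps_gt0 : 0 < eps.
Proof. by apply: lt_le_trans eps_ge; rewrite powR_gt0// ltr0n. Qed.

Lemma ln_eps_ge : - (49 / 100) * ln n%:R <= ln eps.
Proof. by rewrite -ln_powR ler_ln ?posrE ?powR_gt0 ?ltr0n ?eps_gt0. Qed.

Lemma ln_n_ge1 : 1 <= ln n%:R :> R.
Proof. by have := ln_le_subr1 eps_gt0; move: ln_eps_ge eps_le; lra. Qed.

Lemma exists_half_width : exists k', [/\ (0 < k')%N,
  (500 * eps) ^+ 2 * (k'.*2)%:R <= 1 & eps ^- 2 <= 1000 * 1000 * k'%:R].
Proof.
have z_gt0 : 0 < 500 * eps by have := eps_gt0; lra.
have z2_gt0 : 0 < (500 * eps) ^+ 2 by rewrite exprn_gt0.
have z2_le : (500 * eps) ^+ 2 <= 1 / 4.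
  have -> : 1 / 4 = (1 / 2) ^+ 2 :> R by field.
  by rewrite lerXn2r ?nnegrE; move: eps_le z_gt0; lra.
pose x := (500 * eps) ^- 2 / 2.
have x_ge2 : 2 <= x.
  have : (1 / 4)^-1 <= (500 * eps) ^- 2 by rewrite lef_pV2 ?posrE.
  by rewrite /x; lra.
have /andP[k_le k_gt] : (Num.truncn x)%:R <= x < (Num.truncn x).+1%:R.
  by apply: truncn_itv; lra.
rewrite -natr1 in k_gt; exists (Num.truncn x); split.
- by rewrite -(ltr_nat R); lra.
- by rewrite -mul2n natrM mulrC -ler_pdivlMr// div1r; move: k_le; rewrite /x; lra.
have -> : eps ^- 2 = x * (1000 * 500).
  by rewrite /x; field; rewrite gt_eqF//; have := eps_gt0; lra.
by lra.
Qed.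

Lemma ln_width_le k : (0 < k)%N -> (500 * eps) ^+ 2 * k%:R <= 1 ->
  ln k%:R <= 98 / 100 * ln n%:R - 2 * ln 2 :> R.
Proof.
move=> k_gt0 k_le; have e_gt0 := eps_gt0.
have z_gt0 : 0 < 500 * eps by lra.
have kR : 0 < k%:R :> R by rewrite ltr0n.
have : ln (2 * eps) <= ln (500 * eps) by rewrite ler_ln ?posrE ?z_gt0; lra.
have : ln ((500 * eps) ^+ 2 * k%:R) <= 0 by exact: ln_le0.
rewrite (lnM (exprn_gt0 2 z_gt0) kR) (lnXn 2 z_gt0) -[ln _ *+ 2]mulr_natl.
rewrite (lnM (ltr0Sn R 1) e_gt0).
by have := ln_eps_ge; lra.
Qed.

Lemma exists_levels k : (0 < k)%N -> ln k%:R <= 98 / 100 * ln n%:R - 2 * ln 2 :> R ->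
  exists L, [/\ (0 < L)%N, (k * 2 ^ L <= n)%N & 2 / 100 * ln n%:R <= L%:R :> R].
Proof.
move=> k_gt0 ln_k; have kR : 0 < k%:R :> R by rewrite ltr0n.
have nR : 0 < n%:R :> R by rewrite ltr0n.
have kn : (k <= n)%N.
  by rewrite -(ler_nat R) -ler_ln ?posrE//; have := ln_n_ge1; have := @ln2_ge R; lra.
have /andP[L_le L_gt] := trunc_log_bounds (ltnSn 1) (etrans (divn_gt0 n k_gt0) kn).
set L := trunc_log 2 (n %/ k) in L_le L_gt.
have n_le : (n <= k * 2 ^ L.+1)%N.
  by apply: leq_trans (ltnW (ltn_ceil n k_gt0)) _; rewrite mulnC leq_mul2l L_gt orbT.
have p_gt0 : 0 < (2 : R) ^+ L.+1 by rewrite exprn_gt0.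
have ln_n : ln n%:R <= ln k%:R + L%:R * ln 2 + ln 2 :> R.
  have : ln n%:R <= ln (k%:R * 2 ^+ L.+1) :> R.
    by rewrite ler_ln ?posrE ?mulr_gt0// -natrX -natrM ler_nat.
  by rewrite lnM ?posrE// lnXn// -[ln 2 *+ _]mulr_natl -natr1; lra.
have L_ln2 : L%:R * ln 2 <= L%:R :> R by rewrite ler_piMr// ln2_le.
have L_ge : 2 / 100 * ln n%:R <= L%:R :> R by have := @ln2_ge R; lra.
exists L; split=> //; first by rewrite -(ltr_nat R); have := ln_n_ge1; lra.
by apply: leq_trans (leq_divM n k); rewrite mulnC leq_mul2r L_le orbT.
Qed.

Lemma grid_parameters : exists k' L : nat,
  [/\ (0 < k')%N, (0 < L)%N, (k'.*2 * 2 ^ L <= n)%N, (500 * eps) ^+ 2 * (k'.*2)%:R <= 1 &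
      eps ^- 2 * ln n%:R <= 1000 * 1000 * 50 * (L * k')%:R].
Proof.
have [k' [k'_gt0 k_le k'_ge]] := exists_half_width.
have k_gt0 : (0 < k'.*2)%N by rewrite double_gt0.
have [L [L_gt0 kL L_ge]] := exists_levels k_gt0 (ln_width_le k_gt0 k_le).
exists k', L; split=> //; rewrite natrM.
have -> : 1000 * 1000 * 50 * (L%:R * k'%:R) = 1000 * 1000 * k'%:R * (50 * L%:R) :> R.
  by ring.
apply: ler_pM => //; last by lra.
  by rewrite invr_ge0 exprn_ge0// ltW// eps_gt0.
by have := ln_n_ge1; lra.
Qed.

End GridParameters.

Lemma long_stream_length_le a M r n : (0 < a)%N -> (0 < M)%N -> (0 < r)%N ->
  (((a ^ 2 * M ^ 3 * (M + r + r.*2 + a * r)).*2 + r) * n <= 11 * (a ^ 3 * M ^ 4 * r * n))%N.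
Proof.
move=> a_gt0 M_gt0 r_gt0; rewrite mulnA leq_mul//.
have round_le : (M + r + r.*2 + a * r <= 5 * (a * M * r))%N by nia.
have r_le : (r <= a ^ 3 * M ^ 4 * r)%N.
  by rewrite leq_pmull// muln_gt0 !expn_gt0 a_gt0 M_gt0.
have rounds_le : (a ^ 2 * M ^ 3 * (M + r + r.*2 + a * r) <= 5 * (a ^ 3 * M ^ 4 * r))%N.
  apply: leq_trans (leq_mul (leqnn _) round_le) _.
  by rewrite [(a ^ 3)%N]expnSr [(M ^ 4)%N]expnSr; apply: eq_leq; ring.
by lia.
Qed.

Lemma exists_shift_range (R : realType) (x : R) : 1000 <= ln x ->
  exists N, [/\ (0 < N)%N, ln x / 8 <= ln N%:R :> R & ln (N`!)%:R <= x / 8 :> R].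
Proof.
move=> ln_x; have x_gt0 : 0 < x.
  by rewrite ltNge; apply/negP => /ln0 x0; move: ln_x; rewrite x0; lra.
pose q := expR (ln x / 4).
have q4 : q ^+ 2 * q ^+ 2 = x.
  by rewrite -exprD -expRM_natl mulrC divfK ?lnK.
have q_ge : 250 <= q by have := expR_ge1Dx (ln x / 4); rewrite -/q; lra.
have q2_ge : 8 <= q ^+ 2.
  by apply: le_trans (_ : q <= _); [lra | rewrite expr2 ler_peMr; lra].
have /andP[N_le N_gt] : (Num.truncn q)%:R <= q < (Num.truncn q).+1%:R.
  by apply: truncn_itv; lra.
rewrite -natr1 in N_gt; exists (Num.truncn q).
have N_gt0 : 0 < (Num.truncn q)%:R :> R by lra.
split; first by rewrite -(ltr_nat R).
  have : ln q <= ln (2 * (Num.truncn q)%:R) by rewrite ler_ln ?posrE ?mulr_gt0//; lra.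
  by rewrite lnM ?posrE// expRK; have := @ln2_le R; lra.
apply: le_trans (ln_fact_le _ _) _.
have : (Num.truncn q)%:R ^+ 2 <= q ^+ 2 by rewrite lerXn2r ?nnegrE//; lra.
have : 8 * q ^+ 2 <= q ^+ 2 * q ^+ 2 by rewrite ler_wpM2r// sqr_ge0.
by rewrite q4; lra.
Qed.

Section LowerBounds.
Context {R : realType} {n W : nat} {eps C0 : R}.
Hypotheses (n_gt0 : (0 < n)%N) (eps_ge : n%:R `^ (- (49 / 100)) <= eps).
Hypothesis eps_le : eps <= 1 / 1000.
Hypotheses (C0_ge : 1001 <= C0) (ln_C0 : ln C0 = 1000) (W_ge : n%:R `^ C0 <= W%:R).
Context {d : measure_display} {Seed : measurableType d} {P : probability Seed R}.
Context {A : Seed -> det_algorithm R n} {S : nat}.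
Hypotheses (A_approximates : approximates_L0 P A eps W) (A_space : uses_space A S).

Local Notation scale := (eps ^- 2 * ln n%:R).
Local Notation lnW := (ln (W%:R : R)).
(* The factor lost in [grid_parameters] times one that serves both space bounds. *)
Local Notation cost := (1000 * 1000 * 50 * (1000 * 40) : R).

Let n_gt0R : 0 < n%:R :> R. Proof. by rewrite ltr0n. Qed.
Let eps_gt0 : 0 < eps. Proof. exact: eps_gt0 n_gt0 eps_ge. Qed.
Let ln_n_ge1 : 1 <= ln n%:R :> R. Proof. exact: ln_n_ge1 n_gt0 eps_ge eps_le. Qed.

Let W_gt0 : 0 < W%:R :> R.
Proof. exact: lt_le_trans (powR_gt0 _ n_gt0R) W_ge. Qed.

Lemma lnW_ge : C0 * ln n%:R <= lnW.
Proof. by rewrite -ln_powR ler_ln ?posrE ?powR_gt0. Qed.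

Lemma lnW_ge_ln_n : 1001 * ln n%:R <= lnW.
Proof. by apply: le_trans lnW_ge; rewrite ler_wpM2r//; move: ln_n_ge1; lra. Qed.

Lemma lnlnW_ge : 1000 <= ln lnW.
Proof.
have C0_gt0 : 0 < C0 by move: C0_ge; lra.
have C0_le : C0 <= lnW by apply: le_trans lnW_ge; rewrite ler_peMr// ltW.
by rewrite -ln_C0 ler_ln ?posrE// (lt_le_trans C0_gt0).
Qed.

Let lnW_gt0 : 0 < lnW.
Proof. by have := lnW_ge_ln_n; move: ln_n_ge1; lra. Qed.

Lemma ln_scale_ge1 : 1 <= ln scale.
Proof.
have ln_n_gt0 : 0 < ln n%:R :> R by move: ln_n_ge1; lra.
rewrite lnM ?posrE ?invr_gt0 ?exprn_gt0// lnV ?posrE ?exprn_gt0// lnXn// -[_ *+ 2]mulr_natl.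
have := ln_le_subr1 eps_gt0; have := ln_ge0 ln_n_ge1.
by move: eps_le; lra.
Qed.

Let scale_gt0 : 0 < scale.
Proof. by rewrite mulr_gt0 ?invr_gt0 ?exprn_gt0//; move: ln_n_ge1; lra. Qed.

Lemma four_n_le_W : (4 * n <= W)%N.
Proof.
rewrite -(ler_nat R) natrM -ler_ln ?posrE ?mulr_gt0// lnM ?posrE//.
have -> : 4 = 2 * 2 :> R by ring.
by rewrite lnM ?posrE//; have := @ln2_le R; have := lnW_ge_ln_n; move: ln_n_ge1; lra.
Qed.

Lemma space_ge_scale : scale <= cost * S%:R.
Proof.
have [k' [L [k'_gt0 L_gt0 kL eps_small scale_le]]] := grid_parameters n_gt0 eps_ge eps_le.
have [emb emb_inj] := exists_coords_embedding kL.
have k_gt0 : (0 < k'.*2)%N by rewrite double_gt0.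
have := short_stream_space_bound emb_inj A_approximates A_space L_gt0 k_gt0 (ltW eps_gt0)
  eps_small four_n_le_W.
rewrite -muln2 mulnA [X in X <= _]natrM; move: scale_le.
by set Lk := (L * k')%:R; lra.
Qed.

Lemma space_ge_scale_ln N a : (0 < N)%N -> 8 <= ln N%:R :> R -> 1000 * 1000 <= a%:R :> R ->
  (11 * (a ^ 3 * (2 ^ S) ^ 4 * N`! * n) <= W)%N -> scale * ln N%:R <= cost * S%:R.
Proof.
move=> N_gt0 lnN_ge a_large W_large.
have [k' [L [k'_gt0 L_gt0 kL eps_small scale_le]]] := grid_parameters n_gt0 eps_ge eps_le.
have [emb emb_inj] := exists_coords_embedding kL.
have a_gt0 : (0 < a)%N by rewrite -(ltr_nat R); move: a_large; lra.
have M_gt0 : (0 < 2 ^ S)%N by rewrite expn_gt0.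
have length_le := leq_trans (long_stream_length_le n a_gt0 M_gt0 (fact_gt0 N)) W_large.
have := long_stream_space_bound L_gt0 k'_gt0 N_gt0 a_gt0 emb_inj A_approximates A_space
  (ltW eps_gt0) eps_small lnN_ge a_large length_le.
have lnN_ge0 : 0 <= ln N%:R :> R by move: lnN_ge; lra.
have := ler_wpM2r lnN_ge0 scale_le; have : 0 <= S%:R :> R by [].
by set Lk := (L * k')%:R; lra.
Qed.

(* If the scale is below [sqrt (ln W)] this is immediate; otherwise [ln (ln W)]
   is at most twice the logarithm of the scale. *)
Lemma scale_lnlnW_le : scale `^ (C0 * scale) <= W%:R -> scale * ln lnW <= 2 * lnW.
Proof.
move=> W_large; have lnW_large : C0 * scale * ln scale <= lnW.
  by rewrite -ln_powR ler_ln ?posrE ?powR_gt0.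
pose root := Num.sqrt lnW; have root_gt0 : 0 < root by rewrite sqrtr_gt0.
have root2 : root * root = lnW by rewrite -expr2 sqr_sqrtr// ltW.
have lnlnW : ln lnW = 2 * ln root by rewrite -root2 lnM ?posrE//; lra.
have [small|large] := leP scale root.
  have : scale * ln lnW <= root * (2 * root).
    apply: ler_pM => //; [exact: ltW | by have := lnlnW_ge; lra |].
    by rewrite lnlnW; have := ln_sublinear root_gt0; lra.
  by rewrite -root2; lra.
have : scale * ln root <= scale * ln scale.
  by rewrite ler_wpM2l ?(ltW scale_gt0)// ler_ln ?posrE// ltW.
have : 1 * (scale * ln scale) <= C0 * (scale * ln scale).
  apply: ler_wpM2r; last by move: C0_ge; lra.
  by rewrite mulr_ge0 ?(ltW scale_gt0)//; have := ln_scale_ge1; lra.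
by rewrite lnlnW; move: lnW_large; lra.
Qed.

Lemma exists_large_natural : exists2 a : nat, 1000 * 1000 <= a%:R :> R & ln a%:R <= 20 :> R.
Proof.
exists (2 ^ 20)%N; rewrite natrX; first by rewrite !exprS expr0; lra.
by rewrite lnXn// -[ln 2 *+ _]mulr_natl; have := @ln2_le R; lra.
Qed.

Lemma long_stream_fits N a : (0 < N)%N -> 1 <= a%:R :> R -> ln a%:R <= 20 :> R ->
  ln (N`!)%:R <= lnW / 8 -> 4 * S%:R <= lnW / 4 ->
  (11 * (a ^ 3 * (2 ^ S) ^ 4 * N`! * n) <= W)%N.
Proof.
move=> N_gt0 a_ge1 ln_a ln_fact space_small.
have a_gt0 : 0 < a%:R :> R by lra.
have f_gt0 : 0 < (N`!)%:R :> R by rewrite ltr0n fact_gt0.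
have p_gt0 : 0 < (2 : R) ^+ S by rewrite exprn_gt0.
rewrite -(ler_nat R) !natrM !natrX -ler_ln ?posrE ?mulr_gt0 ?exprn_gt0//.
rewrite !lnM ?posrE ?mulr_gt0 ?exprn_gt0// !lnXn ?exprn_gt0// -[ln 2 *+ S]mulr_natl.
have ln11 : ln 11 <= 10 :> R by have := @ln_le_subr1 R 11 (ltr0Sn _ _); lra.
have S_ln2 : S%:R * ln 2 <= S%:R :> R by rewrite ler_piMr// ln2_le.
by have := lnW_ge_ln_n; move: ln_n_ge1; lra.
Qed.

Lemma space_ge_very_long : scale `^ (C0 * scale) <= W%:R -> scale * ln lnW <= 8 * cost * S%:R.
Proof.
move=> /scale_lnlnW_le product_le; rewrite leNgt; apply/negP => space_small.
have [N [N_gt0 ln_N ln_fact]] := exists_shift_range lnlnW_ge.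
have [a a_large ln_a] := exists_large_natural.
have lnN_ge : 8 <= ln N%:R :> R by have := lnlnW_ge; lra.
have fits : (11 * (a ^ 3 * (2 ^ S) ^ 4 * N`! * n) <= W)%N.
  apply: long_stream_fits => //; first by lra.
  by have : 0 <= S%:R :> R by []; lra.
have := space_ge_scale_ln N_gt0 lnN_ge a_large fits.
have : scale * (ln lnW / 8) <= scale * ln N%:R by rewrite ler_wpM2l ?(ltW scale_gt0).
by lra.
Qed.

Lemma space_ge_general : scale * ln lnW / ln (scale * ln lnW) <= 1002 * cost * S%:R.
Proof.
have lnln_ge := lnlnW_ge; have ln_scale := ln_scale_ge1.
have lnln_gt0 : 0 < ln lnW by lra.
have ln_scale_gt0 : 0 < ln scale by lra.
have ln_product : ln (scale * ln lnW) = ln scale + ln (ln lnW) by rewrite lnM ?posrE.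
have lnlnln_ge0 : 0 <= ln (ln lnW) by rewrite ln_ge0//; lra.
have costS_ge0 : 0 <= cost * S%:R by apply: mulr_ge0; [lra | exact: ler0n].
rewrite ler_pdivrMr; last by lra.
have [/space_ge_very_long space_ge|/ltW W_small] := leP (scale `^ (C0 * scale)) W%:R.
  have : 1002 * cost * S%:R * 1 <= 1002 * cost * S%:R * ln (scale * ln lnW).
    by apply: ler_wpM2l; lra.
  by lra.
have C0_gt0 : 0 < C0 by move: C0_ge; lra.
have lnW_le : lnW <= C0 * scale * ln scale.
  by rewrite -ln_powR ler_ln ?posrE ?powR_gt0.
have lnlnW_le : ln lnW <= 1000 + ln scale + ln (ln scale).
  have C0_scale_gt0 := mulr_gt0 C0_gt0 scale_gt0.
  rewrite -ln_C0 -(lnM C0_gt0 scale_gt0) -(lnM C0_scale_gt0 ln_scale_gt0) ler_ln ?posrE//.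
  exact: mulr_gt0.
have := ln_le_subr1 ln_scale_gt0 => lnln_scale.
have : scale * ln lnW <= scale * (1002 * ln (scale * ln lnW)).
  by rewrite ler_wpM2l ?(ltW scale_gt0)//; lra.
have : scale * (1002 * ln (scale * ln lnW)) <= cost * S%:R * (1002 * ln (scale * ln lnW)).
  by apply: (ler_wpM2r _ space_ge_scale); lra.
by lra.
Qed.

End LowerBounds.

Theorem theorem7p2p2 (R : realType) :
  exists c0 C0 c1 c2 : R,
    [/\ 0 < c0, 0 < C0, 0 < c1 & 0 < c2] /\
    forall (n W : nat) (eps : R),
      (0 < n)%N ->
      n%:R `^ (- (49 / 100)) <= eps -> eps <= c0 ->
      n%:R `^ C0 <= W%:R ->
      forall (d : measure_display) (Seed : measurableType d)
        (P : probability Seed R) (A : Seed -> det_algorithm R n) (S : nat),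
        approximates_L0 P A eps W ->
        uses_space A S ->
        c1 * (eps ^- 2 * ln n%:R * ln (ln W%:R)
              / ln (eps ^- 2 * ln n%:R * ln (ln W%:R))) <= S%:R
        /\
        ((eps ^- 2 * ln n%:R) `^ (C0 * (eps ^- 2 * ln n%:R)) <= W%:R ->
         c2 * (eps ^- 2 * ln n%:R * ln (ln W%:R)) <= S%:R).
Proof.
pose cost : R := 1000 * 1000 * 50 * (1000 * 40).
have general_cost_gt0 : 0 < 1002 * cost by rewrite /cost; lra.
have very_long_cost_gt0 : 0 < 8 * cost by rewrite /cost; lra.
have [C0 C0_ge ln_C0] : exists2 C0 : R, 1001 <= C0 & ln C0 = 1000.
  by exists (expR 1000); [have := expR_ge1Dx (1000 : R); lra | exact: expRK].
exists (1 / 1000), C0, (1002 * cost)^-1, (8 * cost)^-1; split.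
  by split; [lra | lra | rewrite invr_gt0 | rewrite invr_gt0].
move=> n W eps n_gt0 eps_ge eps_le W_ge d Seed P A S A_approximates A_space.
split=> [|W_large].
  have := space_ge_general n_gt0 eps_ge eps_le C0_ge ln_C0 W_ge A_approximates A_space.
  by rewrite -/cost ler_pdivrMl.
have := space_ge_very_long n_gt0 eps_ge eps_le C0_ge ln_C0 W_ge A_approximates A_space
  W_large.
by rewrite -/cost ler_pdivrMl.
Qed.
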